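(* Let $(M,g)$ be a generalized Roter type Riemannian manifold of dimension $n\ge 3$. Then the following conditions are equivalent (where in each condition involving $L$, the condition is that it holds for some scalar function $L$ on $M$): (i) $P\cdot\mathcal S=0$; (ii) $P\cdot\mathcal S=L\,Q(g,\mathcal S)$; (iii) $P\cdot\mathcal R=0$; (iv) $P\cdot\mathcal R=L\,Q(g,\mathcal R)$; (v) $P\cdot\mathcal R=L\,Q(S,\mathcal R)$, $L\ne\frac{-1}{n-1}$; (vi) $P\cdot P=0$; (vii) $P\cdot P=L\,Q(g,P)$; (viii) $P\cdot P=L\,Q(S,P)$, $L\ne\frac{-1}{n-1}$; (ix) $P\cdot\mathcal P=0$; (x) $P\cdot\mathcal P=L\,Q(g,\mathcal P)$; (xi) $P\cdot\mathcal P=L\,Q(S,\mathcal P)$, $L\ne\frac{-1}{n-1}$; (xii) $M$ is a manifold of constant curvature.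
   Context: $(M,g)$ is a connected smooth Riemannian manifold of dimension $n\ge 3$; $R$ is the $(0,4)$ Riemann curvature tensor and $\mathcal R$ the $(1,3)$ one, $g(\mathcal R(X,Y)X_1,X_2)=R(X,Y,X_1,X_2)$, with the sign convention that the Ricci tensor $S(X_2,X_3)$ is the $g$-trace of $R(X_1,X_2,X_3,X_4)$ over $X_1,X_4$; $\mathcal S$ is the Ricci operator, $g(\mathcal SX,Y)=S(X,Y)$, and $S^2(X,Y)=g(\mathcal S^2X,Y)$. Kulkarni–Nomizu product: $(A\wedge F)(X_1,X_2,X_3,X_4)=A(X_1,X_4)F(X_2,X_3)+A(X_2,X_3)F(X_1,X_4)-A(X_1,X_3)F(X_2,X_4)-A(X_2,X_4)F(X_1,X_3)$. $M$ is of generalized Roter type if $$R=c_1\,g\wedge g+c_2\,g\wedge S+c_3\,S\wedge S+c_4\,g\wedge S^2+c_5\,S\wedge S^2+c_6\,S^2\wedge S^2$$ for some $c_1,\dots,c_6\in C^\infty(M)$. Projective curvature tensor: $P(X_1,X_2,X_3,X_4)=R(X_1,X_2,X_3,X_4)-\frac{1}{n-1}\left[S(X_2,X_3)g(X_1,X_4)-S(X_1,X_3)g(X_2,X_4)\right]$; $\mathcal P$ is its $(1,3)$-version, $g(\mathcal P(X,Y)X_1,X_2)=P(X,Y,X_1,X_2)$. An endomorphism $\mathscr L$ of vector fields acts on a $(0,k)$-tensor $H$ by $(\mathscr LH)(X_1,\dots,X_k)=-\sum_iH(X_1,\dots,\mathscr LX_i,\dots,X_k)$ and on a $(1,k-1)$-tensor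 $\mathcal H$ by $(\mathscr L\mathcal H)(X_1,\dots,X_{k-1})=\mathscr L(\mathcal H(X_1,\dots,X_{k-1}))-\sum_i\mathcal H(X_1,\dots,\mathscr LX_i,\dots,X_{k-1})$. $P\cdot H$ and $P\cdot\mathcal H$ are obtained with $\mathscr L=\mathcal P(X,Y)$ ($X,Y$ placed as last arguments); for a symmetric $(0,2)$-tensor $A$, $Q(A,H)$ and $Q(A,\mathcal H)$ are obtained with $\mathscr L=X\wedge_AY$, $(X\wedge_AY)Z=A(Y,Z)X-A(X,Z)Y$. *)

(* Defs.v *)
From HB Require Import structures.
From mathcomp Require Import all_boot all_order all_algebra.
From mathcomp Require Import all_classical all_reals topology normedtype derive.

Set Implicit Arguments.
Unset Strict Implicit.
Unset Printing Implicit Defensive.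

Import Order.TTheory GRing.Theory Num.Theory.
Import numFieldNormedType.Exports.

Local Open Scope classical_set_scope.
Local Open Scope ring_scope.

(* [U] is meant to be open: ['d f x] and ['D_v f x] then only depend on the
   values of [f] on [U]. In finite dimension, continuity of ['D_v f] for every
   direction [v] is continuity of the differential. *)
Fixpoint Ck (R : realType) (V W : normedModType R) (k : nat) (U : set V)
    (f : V -> W) : Prop :=
  if k is k'.+1 then
    (forall x, U x -> differentiable f x) /\
    (forall v, Ck k' U (fun x => 'D_v f x))
  else forall x, U x -> {for x, continuous f}.

Definition smooth_on (R : realType) (V W : normedModType R) (U : set V)
    (f : V -> W) : Prop := forall k, Ck k U f.

(* A smooth structure is given by a smooth atlas, not necessarily maximal. Each
   chart is a homeomorphism [chart_map i : chart_dom i -> chart_cod i], with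
   inverse [chart_inv i]; the values of these total functions outside
   [chart_dom i], resp. [chart_cod i], are irrelevant. *)
Record smoothManifold (R : realType) (n : nat) := SmoothManifold {
  carrier :> topologicalType;
  chart_index : Type;
  chart_dom : chart_index -> set carrier;
  chart_cod : chart_index -> set 'rV[R]_n;
  chart_map : chart_index -> carrier -> 'rV[R]_n;
  chart_inv : chart_index -> 'rV[R]_n -> carrier;
  _ : hausdorff_space carrier;
  _ : @second_countable carrier;
  _ : forall p, exists i, chart_dom i p;
  _ : forall i, open (chart_dom i);
  _ : forall i, open (chart_cod i);
  _ : forall i p, chart_dom i p ->
        chart_cod i (chart_map i p) /\ chart_inv i (chart_map i p) = p;
  _ : forall i x, chart_cod i x ->
        chart_dom i (chart_inv i x) /\ chart_map i (chart_inv i x) = x;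
  _ : forall i p, chart_dom i p -> {for p, continuous (chart_map i)};
  _ : forall i x, chart_cod i x -> {for x, continuous (chart_inv i)};
  _ : forall i j,
        smooth_on (chart_cod i `&` chart_inv i @^-1` chart_dom j)
          (chart_map j \o chart_inv i)
}.

Definition smooth_fun (R : realType) (n : nat) (M : smoothManifold R n)
    (f : M -> R) : Prop :=
  forall i : chart_index M, smooth_on (chart_cod i) (f \o chart_inv i).

Section ChartGeometry.
Variables (R : realType) (n : nat).
Notation V := 'rV[R]_n.

(* The bilinear form with Gram matrix [G]. *)
Definition gram (G : 'M[R]_n) (X Y : V) : R := (X *m G *m Y^T) 0 0.

Definition basis_vec (a : 'I_n) : V := delta_mx 0 a.

(* The vector [Z] with [gram G Z W = w W] for all [W], when [w] is linear and
   [G] is symmetric and invertible. *)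
Definition sharp (G : 'M[R]_n) (w : V -> R) : V :=
  (\row_a w (basis_vec a)) *m invmx G.

Definition gtrace (G : 'M[R]_n) (A : V -> V -> R) : R :=
  \sum_a \sum_b invmx G a b * A (basis_vec a) (basis_vec b).

(* In a chart, a metric is a matrix-valued function of the coordinates, and
   tangent vectors at a point are given by their components in the coordinate
   frame. *)
Variable G : V -> 'M[R]_n.

Definition met (x : V) (X Y : V) : R := gram (G x) X Y.

(* Koszul formula for coordinate (that is, constant) vector fields. *)
Definition christoffel (x : V) (X Y : V) : V :=
  sharp (G x) (fun W =>
    2^-1 * ('D_X (fun y => met y Y W) x + 'D_Y (fun y => met y X W) x
            - 'D_W (fun y => met y X Y) x)).

(* Levi-Civita covariant derivative of the vector field [Y] along [X]. *)
Definition nabla (X Y : V -> V) (x : V) : V :=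
  'D_(X x) Y x + christoffel x (X x) (Y x).

(* nabla_X nabla_Y Z - nabla_Y nabla_X Z - nabla_[X,Y] Z, where [X], [Y], [Z]
   are extended to vector fields with constant components, so [X,Y] = 0. *)
Definition Riem13 (x : V) (X Y Z : V) : V :=
  nabla (cst X) (nabla (cst Y) (cst Z)) x
  - nabla (cst Y) (nabla (cst X) (cst Z)) x.

Definition Riem (x : V) (X1 X2 X3 X4 : V) : R :=
  met x (Riem13 x X1 X2 X3) X4.

Definition Ric (x : V) (X2 X3 : V) : R :=
  gtrace (G x) (fun X1 X4 => Riem x X1 X2 X3 X4).

Definition RicOp (x : V) (X : V) : V := sharp (G x) (Ric x X).

Definition Ric2 (x : V) (X Y : V) : R := met x (RicOp x (RicOp x X)) Y.

Definition Proj (x : V) (X1 X2 X3 X4 : V) : R :=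
  Riem x X1 X2 X3 X4
  - (n%:R - 1)^-1 * (Ric x X2 X3 * met x X1 X4 - Ric x X1 X3 * met x X2 X4).

Definition Proj13 (x : V) (X Y Z : V) : V := sharp (G x) (Proj x X Y Z).

Definition sectional (x : V) (X Y : V) : R :=
  Riem x X Y Y X / (met x X X * met x Y Y - met x X Y ^+ 2).

End ChartGeometry.

Section TensorAlgebra.
Variables (R : realType) (n : nat).
Notation V := 'rV[R]_n.

Definition kulkarni_nomizu (A F : V -> V -> R) (X1 X2 X3 X4 : V) : R :=
  A X1 X4 * F X2 X3 + A X2 X3 * F X1 X4
  - A X1 X3 * F X2 X4 - A X2 X4 * F X1 X3.

Definition wedge_endo (A : V -> V -> R) (X Y Z : V) : V :=
  A Y Z *: X - A X Z *: Y.

(* Action of an endomorphism on tensors of type (0,4), (1,1) and (1,3). *)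
Definition act04 (T : V -> V) (H : V -> V -> V -> V -> R)
    (X1 X2 X3 X4 : V) : R :=
  - (H (T X1) X2 X3 X4 + H X1 (T X2) X3 X4
     + H X1 X2 (T X3) X4 + H X1 X2 X3 (T X4)).

Definition act11 (T : V -> V) (H : V -> V) (X1 : V) : V :=
  T (H X1) - H (T X1).

Definition act13 (T : V -> V) (H : V -> V -> V -> V) (X1 X2 X3 : V) : V :=
  T (H X1 X2 X3)
  - (H (T X1) X2 X3 + H X1 (T X2) X3 + H X1 X2 (T X3)).

(* [E X Y] is the endomorphism attached to the last two arguments: it is
   [Proj13 G x] for the products P . H, and [wedge_endo A] for Q(A, H). *)
Definition dot04 (E : V -> V -> V -> V) (H : V -> V -> V -> V -> R)
    (X1 X2 X3 X4 X Y : V) : R := act04 (E X Y) H X1 X2 X3 X4.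

Definition dot11 (E : V -> V -> V -> V) (H : V -> V) (X1 X Y : V) : V :=
  act11 (E X Y) H X1.

Definition dot13 (E : V -> V -> V -> V) (H : V -> V -> V -> V)
    (X1 X2 X3 X Y : V) : V := act13 (E X Y) H X1 X2 X3.

Definition Q04 (A : V -> V -> R) := dot04 (wedge_endo A).
Definition Q11 (A : V -> V -> R) := dot11 (wedge_endo A).
Definition Q13 (A : V -> V -> R) := dot13 (wedge_endo A).

End TensorAlgebra.

(* The metric is given by its Gram matrices in the charts; the last field is
   the transformation law under changes of charts. *)
Record riemannianManifold (R : realType) (n : nat) := RiemannianManifold {
  manifold :> smoothManifold R n;
  metric : chart_index manifold -> 'rV[R]_n -> 'M[R]_n;
  _ : forall i a b, smooth_on (chart_cod i) (fun x => metric i x a b);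
  _ : forall i x, chart_cod i x -> (metric i x)^T = metric i x;
  _ : forall i x X, chart_cod i x -> X != 0 -> 0 < gram (metric i x) X X;
  _ : forall i j x X Y, chart_cod i x -> chart_dom j (chart_inv i x) ->
        let phi := chart_map j \o chart_inv i in
        gram (metric i x) X Y = gram (metric j (phi x)) ('d phi x X) ('d phi x Y)
}.

(* [C G x p] holds at every point [p] of [M], in every chart around [p], where
   [G] is the metric in the chart and [x] are the coordinates of [p]. *)
Definition everywhere (R : realType) (n : nat) (M : riemannianManifold R n)
    (C : ('rV[R]_n -> 'M[R]_n) -> 'rV[R]_n -> M -> Prop) : Prop :=
  forall (i : chart_index M) (x : 'rV[R]_n), chart_cod i x ->
    C (metric i) x (chart_inv i x).

Definition generalized_Roter (R : realType) (n : nat)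
    (M : riemannianManifold R n) : Prop :=
  exists c1 c2 c3 c4 c5 c6 : M -> R,
    (smooth_fun c1 /\ smooth_fun c2 /\ smooth_fun c3 /\
     smooth_fun c4 /\ smooth_fun c5 /\ smooth_fun c6) /\
    everywhere (M := M) (fun G x p => forall X1 X2 X3 X4,
      let g := met G x in let S := Ric G x in let S2 := Ric2 G x in
      Riem G x X1 X2 X3 X4 =
        c1 p * kulkarni_nomizu g g X1 X2 X3 X4
        + c2 p * kulkarni_nomizu g S X1 X2 X3 X4
        + c3 p * kulkarni_nomizu S S X1 X2 X3 X4
        + c4 p * kulkarni_nomizu g S2 X1 X2 X3 X4
        + c5 p * kulkarni_nomizu S S2 X1 X2 X3 X4
        + c6 p * kulkarni_nomizu S2 S2 X1 X2 X3 X4).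

(* The sectional curvatures of all tangent planes at all points are equal. *)
Definition constant_curvature (R : realType) (n : nat)
    (M : riemannianManifold R n) : Prop :=
  exists k : R, everywhere (M := M) (fun G x _ => forall X Y,
    row_free (col_mx X Y) -> sectional G x X Y = k).

(* Main.v *)
(** All conditions are pointwise and algebraic except constancy of the curvature. At a point, let
    [a], [b] be orthonormal eigenvectors of the Ricci operator with distinct eigenvalues [al], [be].
    The Roter form makes [P(a, b)] minus [L] times [a wedge b] an endomorphism [T] with [T b = p a],
    [T a = - q b], [T = 0] on the orthogonal complement, and [p - q] is a nonzero multiple of
    [al - be]; so [p] and [q] are not both zero. If [T] annihilates the Ricci operator, or the
    (0,4)-tensor [P], then evaluation on [a] and [b] gives [al = be]. If it annihilates the
    (1,3)-tensor [R] or [P], then [R(a, Z, Z', a) = R(b, Z, Z', b)] for [Z], [Z'] orthogonal to [a]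
    and [b], and taking the trace gives [al = be]. As extremal values of the Rayleigh quotient of the
    Ricci operator are eigenvalues, the Ricci tensor is a multiple of [g], hence by the Roter form so
    is [R] of [g wedge g]. The factor is constant by Schur's lemma: it is independent of the chart,
    its derivative vanishes by the second Bianchi identity as [n >= 3], and [M] is connected.
    Conversely constant curvature gives [P = 0]. *)

Require Import Defs.
From mathcomp Require Import all_boot all_order all_algebra.
From mathcomp Require Import all_classical all_reals topology normedtype derive.
From mathcomp Require Import landau ring lra zify.
Import Order.TTheory GRing.Theory Num.Theory.
Import numFieldNormedType.Exports.
Local Open Scope classical_set_scope.
Local Open Scope ring_scope.

Set Implicit Arguments.
Unset Strict Implicit.
Unset Printing Implicit Defensive.

(** * Smooth functions and symmetry of second derivatives *)

(** With [m = 1 / (n - 1)], [kappa = R(a, b, b, a)] and [Ba], [Bb] the eigenvalues at [a], [b] of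
    the form [B], which is [g] or [S], the two numbers of the overview are [p = kappa - m be - L Bb]
    and [q = kappa - m al - L Ba]. The unknown [kappa] cancels in
    [p - q = m (al - be) - L (Bb - Ba)]. This is [m (al - be)] for Q(g, H) and [(m + L) (al - be)]
    for Q(S, H), which is where the excluded value of [L] comes from. As nothing is known of [p] and
    [q] separately, each condition is evaluated twice, to give [p k = 0] and [q k = 0] with the same
    [k]. Only two eigenvectors are ever used, for the largest and the smallest eigenvalue, so no
    diagonalisation of the Ricci operator is required. On the analytic side vectors are rows and the
    connection acts on them by matrices on the right, which turns the Bianchi identities and the
    change of charts into identities between products of matrices. Only the metric is given as a
    tensor, so the naturality of its curvature has to be derived, from the uniqueness of the
    Levi-Civita connection. *)

Section SmoothCalculus.
Context {R : realType} {V : normedModType R}.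
Implicit Types (U : set V) (f g : V -> R).

(** The first-order expansion in [diff_locallyP] sees only the germ: that of [f] is also one of [g],
    and [diff_unique] identifies its linear part with the differential of [g]. *)
Lemma near_eq_differentiable (W : normedModType R) (f g : V -> W) x :
  (\near x, f x = g x) -> differentiable f x -> differentiable g x.
Proof.
move=> fg df.
have fgx : f x = g x by exact: nbhs_singleton fg.
have [dfc dfE] := (diff_locallyP x f).1 df.
have dgE : g \o shift x = cst (g x) + 'd f x +o_ (0 : V) id.
  apply/eqaddoP => e e0.
  have /eqaddoP/(_ e e0) := dfE.
  have fg0 : \forall h \near 0, f (h + x) = g (h + x).
    by rewrite (near_shift x); apply: filterS fg => z /=; rewrite sub0r subrK.
  apply: filterS2 fg0 => h; rewrite /= => fgh.
  by rewrite /shift /= !fctE fgh fgx.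
by apply/diff_locallyP; have -> := diff_unique dfc dgE.
Unshelve. all: by end_near. Qed.

(** On an open set, agreement of the values forces agreement of the directional derivatives, which
    keeps the induction going. *)
Lemma Ck_ext (W : normedModType R) k U (f g : V -> W) :
  open U -> (forall x, U x -> f x = g x) -> Ck k U f -> Ck k U g.
Proof.
move=> oU; elim: k f g => [|k IH] f g fg /=.
  move=> fc x Ux.
  have nfg : \near x, f x = g x.
    by apply: filterS (open_nbhs_nbhs (conj oU Ux)); exact: fg.
  move/(_ x Ux): fc; rewrite /prop_for /continuous_at (fg _ Ux) => fc.
  by apply: cvg_trans fc; apply: near_eq_cvg.
case=> [df Df]; split.
  move=> x Ux; apply: near_eq_differentiable (df x Ux).
  by apply: filterS (open_nbhs_nbhs (conj oU Ux)); exact: fg.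
move=> v; apply: IH (Df v) => x Ux.
apply: near_eq_derive; apply: filterS (open_nbhs_nbhs (conj oU Ux)); exact: fg.
Qed.

(** The rules for products and inverses bring back undifferentiated factors, so their inductions
    need the lower order too. *)
Lemma Ck_prev (W : normedModType R) k U (f : V -> W) : Ck k.+1 U f -> Ck k U f.
Proof.
elim: k f => [|k IH] f [df Df]; first by move=> x Ux; exact/differentiable_continuous/df.
by split=> // v; apply: IH.
Qed.

Lemma Ck_cst (W : normedModType R) k U (a : W) : Ck k U (fun _ : V => a).
Proof.
elim: k a => [|k IH] a /=; first by move=> x _; exact: cvg_cst.
split=> [x _|v]; first exact: differentiable_cst.
have -> : (fun x => 'D_v (fun _ : V => a) x) = (fun _ => 0); last exact: IH.
by apply/funext => x; rewrite derive_cst.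
Qed.

Lemma Ck_add (W : normedModType R) k U (f g : V -> W) : open U ->
  Ck k U f -> Ck k U g -> Ck k U (fun x => f x + g x).
Proof.
move=> oU; elim: k f g => [|k IH] f g /=.
  by move=> cf cg x Ux; apply: cvgD; [exact: cf|exact: cg].
move=> [df Df] [dg Dg]; split.
  by move=> x Ux; apply: differentiableD; auto.
move=> v; apply: Ck_ext (IH _ _ (Df v) (Dg v)) => // x Ux.
by rewrite -deriveD //; apply: diff_derivable; auto.
Qed.

Lemma Ck_mul k U f g : open U ->
  Ck k U f -> Ck k U g -> Ck k U (fun x => f x * g x).
Proof.
move=> oU; elim: k f g => [|k IH] f g.
  by move=> cf cg x Ux; apply: cvgM; [exact: cf|exact: cg].
move=> Cf Cg; have [df Df] := Cf; have [dg Dg] := Cg; split.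
  by move=> x Ux; apply: differentiableM; auto.
move=> v; apply: (@Ck_ext _ _ _ (fun x => f x * 'D_v g x + g x * 'D_v f x)) => //.
  by move=> x Ux; rewrite -deriveM //; apply: diff_derivable; auto.
by apply: Ck_add => //; apply: IH; first [exact: Df | exact: Dg | exact: Ck_prev].
Qed.

Lemma Ck_inv k U f : open U -> (forall x, U x -> f x != 0) ->
  Ck k U f -> Ck k U (fun x => (f x)^-1).
Proof.
move=> oU f0; elim: k => [|k IH].
  by move=> cf x Ux; apply: cvgV; [exact: f0|exact: cf].
move=> Cf; have [df Df] := Cf; split.
  by move=> x Ux; apply: differentiableV; auto.
move=> v; apply: (@Ck_ext _ _ _ (fun x => (-1 * ((f x)^-1 * (f x)^-1)) * 'D_v f x)) => //.
  move=> x Ux; rewrite deriveV ?f0//; last by apply: diff_derivable; auto.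
  by rewrite mulN1r -invfM -expr2.
apply: Ck_mul => //; last exact: Df.
by apply: Ck_mul => //; [exact: Ck_cst|apply: Ck_mul => //; apply: IH; exact: Ck_prev].
Qed.

Section SmoothOn.
Variable U : set V.
Hypothesis oU : open U.

Lemma smooth_ext (W : normedModType R) (f g : V -> W) :
  (forall x, U x -> f x = g x) -> smooth_on U f -> smooth_on U g.
Proof. by move=> fg sf k; exact: Ck_ext (sf k). Qed.

Lemma smooth_cst (W : normedModType R) (a : W) : smooth_on U (fun _ : V => a).
Proof. by move=> k; exact: Ck_cst. Qed.

Lemma smooth_add (W : normedModType R) (f g : V -> W) :
  smooth_on U f -> smooth_on U g -> smooth_on U (fun x => f x + g x).
Proof. by move=> sf sg k; exact: Ck_add. Qed.

Lemma smooth_mul f g :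
  smooth_on U f -> smooth_on U g -> smooth_on U (fun x => f x * g x).
Proof. by move=> sf sg k; exact: Ck_mul. Qed.

Lemma smooth_opp f : smooth_on U f -> smooth_on U (fun x => - f x).
Proof.
move=> sf; apply: (@smooth_ext _ (fun x => -1 * f x)).
  by move=> x _; rewrite mulN1r.
by apply: smooth_mul => //; exact: smooth_cst.
Qed.

Lemma smooth_inv f : (forall x, U x -> f x != 0) ->
  smooth_on U f -> smooth_on U (fun x => (f x)^-1).
Proof. by move=> f0 sf k; exact: Ck_inv. Qed.

Lemma smooth_sum (I : Type) (r : seq I) (P : pred I) (F : I -> V -> R) :
  (forall i, smooth_on U (F i)) ->
  smooth_on U (fun x => \sum_(i <- r | P i) F i x).
Proof.
move=> sF; elim: r => [|i r IH].
  by apply: (@smooth_ext _ (fun _ => 0)) => [x _|]; [rewrite big_nil|exact: smooth_cst].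
case Pi : (P i); last by apply: smooth_ext IH => x _; rewrite big_cons Pi.
by apply: smooth_ext (smooth_add (sF i) IH) => x _; rewrite big_cons Pi.
Qed.

Lemma smooth_prod (I : Type) (r : seq I) (P : pred I) (F : I -> V -> R) :
  (forall i, smooth_on U (F i)) ->
  smooth_on U (fun x => \prod_(i <- r | P i) F i x).
Proof.
move=> sF; elim: r => [|i r IH].
  by apply: (@smooth_ext R (fun _ => 1 : R)) => [x _|]; [rewrite big_nil|exact: smooth_cst].
case Pi : (P i); last by apply: smooth_ext IH => x _; rewrite big_cons Pi.
by apply: smooth_ext (smooth_mul (sF i) IH) => x _; rewrite big_cons Pi.
Qed.

Lemma smooth_derive (W : normedModType R) (f : V -> W) v :
  smooth_on U f -> smooth_on U (fun x => 'D_v f x).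
Proof. by move=> sf k; have [_ Df] := sf k.+1; exact: Df. Qed.

Lemma smooth_diff (W : normedModType R) (f : V -> W) x :
  smooth_on U f -> U x -> differentiable f x.
Proof. by move=> sf Ux; have [df _] := sf 1; exact: df. Qed.

Lemma smooth_coord m n (M : V -> 'M[R]_(m, n)) i j :
  smooth_on U M -> smooth_on U (fun x => M x i j).
Proof.
move=> sM k; elim: k M sM => [|k IH] M sM.
  move=> x Ux; apply: (@continuous_comp _ _ _ M (fun N : 'M_(m, n) => N i j)).
    exact: (sM 0).
  exact: coord_continuous.
split=> [x Ux|v].
  apply: (@differentiable_comp _ _ _ _ M (fun N : 'M_(m, n) => N i j)).
    exact: smooth_diff sM Ux.
  exact: differentiable_coord.
apply: Ck_ext (IH _ (smooth_derive v sM)) => // x Ux.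
rewrite derive_mx ?mxE //; apply: diff_derivable; exact: smooth_diff sM Ux.
Qed.

End SmoothOn.

Lemma is_derive_line f (z u : V) (s : R) : differentiable f (s *: u + z) ->
  is_derive s 1 (fun t : R => f (t *: u + z)) ('D_u f (s *: u + z)).
Proof.
move=> df; have Df := diff_derivable (v := u) df.
have E : (fun h : R =>
      h^-1 *: (((fun t : R => f (t *: u + z)) \o shift s) (h *: (1 : R)) - f (s *: u + z)))
   = (fun h => h^-1 *: ((f \o shift (s *: u + z)) (h *: u) - f (s *: u + z))).
  by apply/funext => h /=; rewrite [h *: (1 : R)]mulr1 scalerDl addrA.
by split; rewrite /derivable /derive E.
Qed.

(** The mean value theorem is applied twice: to the increment of [f] by [h *: v] along the direction
    [u], then to the derivative of [f] along [u] on a segment of direction [v]. *)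
Lemma second_difference U f (x u v : V) (h : R) : open U ->
  smooth_on U f -> 0 < h ->
  (forall s t : R, 0 <= s <= h -> 0 <= t <= h -> U (s *: u + (t *: v + x))) ->
  exists s t : R, [/\ 0 <= s <= h, 0 <= t <= h &
    f (h *: u + (h *: v + x)) - f (h *: u + x) - f (h *: v + x) + f x =
    'D_v (fun y => 'D_u f y) (s *: u + (t *: v + x)) * h * h].
Proof.
move=> oU sf h0 UU.
have hh : 0 <= h <= h by rewrite lexx ltW.
have h00 : 0 <= (0 : R) <= h by rewrite lexx ltW.
have U1 s : 0 <= s <= h -> U (s *: u + x).
  by move=> sh; have := UU s 0 sh h00; rewrite scale0r add0r.
pose a (s : R) := f (s *: u + (h *: v + x)) - f (s *: u + x).
pose a' (s : R) := 'D_u f (s *: u + (h *: v + x)) - 'D_u f (s *: u + x).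
have da s : 0 <= s <= h -> is_derive s 1 a (a' s).
  move=> sh; apply: is_deriveB; apply: is_derive_line; apply: smooth_diff sf _ => //.
    exact: UU.
  exact: U1.
have [||s sh Es] := @MVT R a a' 0 h h0.
- by move=> s; rewrite in_itv /= => /andP[s0 sh]; apply: da; rewrite !ltW.
- apply: continuous_in_subspaceT => s; rewrite inE /= in_itv /= => sh.
  have [+ _] := da s sh.
  by move=> /derivable1_diffP/differentiable_continuous.
have {}sh : 0 <= s <= h by move: sh; rewrite in_itv /= => /andP[? ?]; rewrite !ltW.
pose b (t : R) := 'D_u f (t *: v + (s *: u + x)).
pose b' (t : R) := 'D_v (fun y => 'D_u f y) (t *: v + (s *: u + x)).
have UU' t : 0 <= t <= h -> U (t *: v + (s *: u + x)).
  by move=> th; rewrite addrCA; exact: UU.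
have db t : 0 <= t <= h -> is_derive t 1 b (b' t).
  move=> th; apply: (@is_derive_line (fun y => 'D_u f y)).
  apply: smooth_diff (smooth_derive u sf) _ => //; exact: UU'.
have [||t th Et] := @MVT R b b' 0 h h0.
- by move=> t; rewrite in_itv /= => /andP[t0 th]; apply: db; rewrite !ltW.
- apply: continuous_in_subspaceT => t; rewrite inE /= in_itv /= => th.
  have [+ _] := db t th.
  by move=> /derivable1_diffP/differentiable_continuous.
have {}th : 0 <= t <= h by move: th; rewrite in_itv /= => /andP[? ?]; rewrite !ltW.
exists s, t; split => //.
move: Es Et; rewrite /a /a' /b /b' !subr0 !scale0r !add0r => Es Et.
rewrite [s *: u + (t *: v + x)]addrCA -Et [h *: v + (s *: u + x)]addrCA -Es.
by rewrite opprB; ring.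
Qed.

(** The second difference is symmetric in [u] and [v], so the two mixed derivatives share a value at
    points arbitrarily close to [x], where both are continuous. *)
Lemma schwarz U f (x u v : V) : open U -> smooth_on U f -> U x ->
  'D_v (fun y => 'D_u f y) x = 'D_u (fun y => 'D_v f y) x.
Proof.
move=> oU sf Ux.
set F := fun y => 'D_v (fun z => 'D_u f z) y.
set G := fun y => 'D_u (fun z => 'D_v f z) y.
have cF : {for x, continuous F}.
  apply/differentiable_continuous/(smooth_diff _ Ux).
  by do 2!apply: smooth_derive.
have cG : {for x, continuous G}.
  apply/differentiable_continuous/(smooth_diff _ Ux).
  by do 2!apply: smooth_derive.
rewrite -/(F x) -/(G x).
apply/eqP; rewrite -subr_eq0 -normr_le0; apply/ler_addgt0Pr => e e0; rewrite add0r.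
have e2 : 0 < e / 2 by rewrite divr_gt0.
have nU : \near x, U x by exact: open_nbhs_nbhs.
move/cvgrPdist_lt/(_ _ e2): cF => cF; move/cvgrPdist_lt/(_ _ e2): cG => cG.
have [r /= r0 Br] := (nbhs_ballP _ _).1 (filterI nU (filterI cF cG)).
pose m := `|u| + `|v| + 1.
have m0 : 0 < m by rewrite ltr_wpDl ?addr_ge0.
(* As [h * m = r / 2], the points [s *: u + (t *: v + x)] with [s] and [t] in [[0, h]] stay in the
   ball of radius [r]. *)
pose h := r / m / 2.
have h0 : 0 < h by rewrite !divr_gt0.
have inB s t : 0 <= s <= h -> 0 <= t <= h -> ball x r (s *: u + (t *: v + x)).
  move=> /andP[s0 sh] /andP[t0 th]; rewrite -ball_normE /ball_ /= distrC addrA addrK.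
  apply: le_lt_trans (ler_normD _ _) _; rewrite !normrZ !ger0_norm //.
  apply: (@le_lt_trans _ _ (h * m)).
    rewrite /m !mulrDr; apply: ler_wpDr; first by rewrite mulr1 ltW.
    by apply: lerD; apply: ler_wpM2r.
  by rewrite /h mulrAC divfK ?gt_eqF // ltr_pdivrMr // ltr_pMr // ltr1n.
have [|s [t [sh th E1]]] := @second_difference U f x u v h oU sf h0.
  by move=> s t sh th; have [] := Br _ (inB _ _ sh th).
have [|t' [s' [th' sh' E2]]] := @second_difference U f x v u h oU sf h0.
  by move=> s' t' sh' th'; have [+ _] := Br _ (inB _ _ th' sh'); rewrite addrCA.
have FG : F (s *: u + (t *: v + x)) = G (s' *: u + (t' *: v + x)).
  have hn : h != 0 by rewrite gt_eqF.
  apply: (mulIf hn); apply: (mulIf hn).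
  apply: (etrans (esym E1)); rewrite [s' *: u + _]addrCA; apply: (etrans _ E2).
  by rewrite [h *: v + (h *: u + x)]addrCA; ring.
clear E1 E2; clearbody F G.
have [_ [+ _]] := Br _ (inB _ _ sh th).
have [_ [_]] := Br _ (inB _ _ sh' th').
rewrite /= -FG => H1 H2.
rewrite (splitr e); apply: ltW.
rewrite -(subrKA (F (s *: u + (t *: v + x)))).
by apply: le_lt_trans (ler_normD _ _) _; apply: ltrD => //; rewrite distrC.
Qed.

Lemma derive0_ball f (x y : V) (r : R) :
  (forall z, ball x r z -> differentiable f z /\ forall v, 'D_v f z = 0) ->
  ball x r y -> f y = f x.
Proof.
move=> df xy.
pose a (s : R) := f (s *: (y - x) + x).
have inB s : 0 <= s <= 1 -> ball x r (s *: (y - x) + x).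
  move=> /andP[s0 s1]; rewrite -ball_normE /ball_ /= distrC addrK normrZ ger0_norm //.
  apply: le_lt_trans (ler_piMl _ s1) _ => //.
  by move: xy; rewrite -ball_normE /ball_ /= distrC.
have da (s : R) : 0 <= s <= 1 -> is_derive s 1 a 0.
  move=> sh; have [d D0] := df _ (inB s sh).
  by rewrite -(D0 (y - x)); apply: is_derive_line.
have [||s sh] := @MVT R a (fun _ => 0) 0 1 ltr01.
- by move=> s; rewrite in_itv /= => /andP[s0 sh]; apply: da; rewrite !ltW.
- apply: continuous_in_subspaceT => s; rewrite inE /= in_itv /= => sh.
  have [+ _] := da s sh.
  by move=> /derivable1_diffP/differentiable_continuous.
by rewrite mul0r /a scale1r scale0r add0r subrK => /eqP; rewrite subr_eq0 => /eqP.
Qed.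

End SmoothCalculus.

(** * Matrix-valued functions *)

(* Atoms are generalised first, since unification would unfold derivatives and connections. *)
Ltac mxatoms t :=
  lazymatch t with
  | ?A + ?B => mxatoms A; mxatoms B
  | - ?A => mxatoms A
  | ?a *: ?A => mxatoms A
  | ?A *m ?B => mxatoms A; mxatoms B
  | ?A^T => mxatoms A
  | 0 => idtac
  | _ => tryif is_var t then idtac else (generalize t; intro)
  end.

(** Products are expanded and then frozen, so that an identity between sums of noncommuting products
    becomes a [ring] identity on entries. *)
Ltac mxabel :=
  lazymatch goal with |- ?L = ?R => mxatoms L; mxatoms R end;
  rewrite ?(mulmxDl, mulmxDr, mulmxBl, mulmxBr, mulNmx, mulmxN, mulmxA, opprD, opprK,
            mulmx0, mul0mx);
  repeat match goal with |- context[@mulmx ?r ?m ?k ?p ?A ?B] =>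
    let q := fresh in set q := @mulmx r m k p A B; clearbody q end;
  apply/matrixP => ? ?; rewrite ?mxE; ring.

Section MatrixCalculus.
Context {R : realType} {V : normedModType R}.

(** Stated on entries, so that the calculus of real-valued functions applies to matrix products. *)
Definition mdiff m n (M : V -> 'M[R]_(m, n)) x :=
  forall i j, differentiable (fun y => M y i j : R) x.

Definition msmooth (U : set V) m n (M : V -> 'M[R]_(m, n)) :=
  forall i j, smooth_on U (fun y => M y i j : R).

Section AtPoint.
Variable x : V.

Lemma mdiff_derivable m n (M : V -> 'M[R]_(m, n)) v : mdiff M x -> derivable M x v.
Proof. by move=> dM; apply/derivable_mxP => i j; apply: diff_derivable. Qed.

Lemma derive_mxE m n (M : V -> 'M[R]_(m, n)) v i j : mdiff M x ->
  ('D_v M x) i j = 'D_v (fun y => M y i j) x.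
Proof. by move=> dM; rewrite derive_mx ?mxE //; exact: mdiff_derivable. Qed.

Lemma derive_mx_diff m n (M : V -> 'M[R]_(m, n)) v i j : mdiff M x ->
  ('D_v M x) i j = 'd (fun y => M y i j : R) x v.
Proof. by move=> dM; rewrite (derive_mxE v i j dM) (deriveE v (dM i j)). Qed.

Lemma mdiff_cst m n (M : 'M[R]_(m, n)) : mdiff (fun _ => M) x.
Proof. by move=> i j; exact: differentiable_cst. Qed.

Lemma mdiff_add m n (M N : V -> 'M[R]_(m, n)) : mdiff M x -> mdiff N x ->
  mdiff (fun y => M y + N y) x.
Proof.
move=> dM dN i j; rewrite (_ : (fun y => _) = (fun y => M y i j) + (fun y => N y i j)).
  by apply: differentiableD.
by apply/funext => y; rewrite mxE.
Qed.

Lemma mdiff_mul m n p (M : V -> 'M[R]_(m, n)) (N : V -> 'M[R]_(n, p)) :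
  mdiff M x -> mdiff N x -> mdiff (fun y => M y *m N y) x.
Proof.
move=> dM dN i j.
rewrite (_ : (fun y => _) = \sum_k ((fun y => M y i k) * (fun y => N y k j))).
  by apply: differentiable_sum => k; apply: differentiableM.
by apply/funext => y; rewrite mxE fct_sumE.
Qed.

Lemma mdiff_tr m n (M : V -> 'M[R]_(m, n)) : mdiff M x -> mdiff (fun y => (M y)^T) x.
Proof.
move=> dM i j; rewrite (_ : (fun y => _) = (fun y => M y j i)) //.
by apply/funext => y; rewrite mxE.
Qed.

Lemma derive_mulmx m n p (M : V -> 'M[R]_(m, n)) (N : V -> 'M[R]_(n, p)) v :
  mdiff M x -> mdiff N x ->
  'D_v (fun y => M y *m N y) x = 'D_v M x *m N x + M x *m 'D_v N x.
Proof.
move=> dM dN; apply/matrixP => i j; rewrite derive_mxE; last exact: mdiff_mul.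
rewrite (_ : (fun y => _) = \sum_k ((fun y => M y i k) * (fun y => N y k j))); last first.
  by apply/funext => y; rewrite mxE fct_sumE.
rewrite derive_sum => [|k]; last by apply: derivableM; apply: diff_derivable.
rewrite !mxE -big_split /=; apply: eq_bigr => k _.
rewrite deriveM; [|exact: diff_derivable..].
by rewrite (derive_mxE _ _ _ dM) (derive_mxE _ _ _ dN) [LHS]addrC; congr (_ + _); exact: mulrC.
Qed.

Lemma derive_mull m n p (C : 'M[R]_(m, n)) (N : V -> 'M[R]_(n, p)) v :
  mdiff N x -> 'D_v (fun y => C *m N y) x = C *m 'D_v N x.
Proof.
move=> dN; rewrite (derive_mulmx v (mdiff_cst C) dN).
by rewrite derive_cst mul0mx add0r.
Qed.

Lemma derive_mulr m n p (M : V -> 'M[R]_(m, n)) (C : 'M[R]_(n, p)) v :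
  mdiff M x -> 'D_v (fun y => M y *m C) x = 'D_v M x *m C.
Proof.
move=> dM; rewrite (derive_mulmx v dM (mdiff_cst C)).
by rewrite derive_cst mulmx0 addr0.
Qed.

Lemma derive_trmx m n (M : V -> 'M[R]_(m, n)) v :
  mdiff M x -> 'D_v (fun y => (M y)^T) x = ('D_v M x)^T.
Proof.
move=> dM; apply/matrixP => i j; rewrite derive_mxE ?mxE ?derive_mxE //; last exact: mdiff_tr.
by congr ('D_v _ x); apply/funext => y; rewrite mxE.
Qed.

Lemma derive_addmx m n (M N : V -> 'M[R]_(m, n)) v : mdiff M x -> mdiff N x ->
  'D_v (fun y => M y + N y) x = 'D_v M x + 'D_v N x.
Proof. by move=> dM dN; rewrite -deriveD //; exact: mdiff_derivable. Qed.

Lemma derive_oppmx m n (M : V -> 'M[R]_(m, n)) v : mdiff M x ->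
  'D_v (fun y => - M y) x = - 'D_v M x.
Proof. by move=> dM; rewrite -deriveN //; exact: mdiff_derivable. Qed.

Lemma derive_dirD m n (M : V -> 'M[R]_(m, n)) u v : mdiff M x ->
  'D_(u + v) M x = 'D_u M x + 'D_v M x.
Proof.
move=> dM; apply/matrixP => i j; apply: (etrans (derive_mx_diff _ _ _ dM)).
rewrite [RHS]mxE linearD /=; congr (_ + _);
  by apply: esym; exact: derive_mx_diff.
Qed.

Lemma derive_dirZ m n (M : V -> 'M[R]_(m, n)) a u : mdiff M x ->
  'D_(a *: u) M x = a *: 'D_u M x.
Proof.
move=> dM; apply/matrixP => i j; apply: (etrans (derive_mx_diff _ _ _ dM)).
rewrite [RHS]mxE linearZ /=; congr (_ * _);
  by apply: esym; exact: derive_mx_diff.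
Qed.

Lemma derive_dir_sum m n (M : V -> 'M[R]_(m, n)) I (r : seq I) (c : I -> R) (u : I -> V) :
  mdiff M x -> 'D_(\sum_(k <- r) c k *: u k) M x = \sum_(k <- r) c k *: 'D_(u k) M x.
Proof.
move=> dM; elim: r => [|k r IH]; first by rewrite !big_nil derive0.
by rewrite !big_cons derive_dirD // derive_dirZ // IH.
Qed.

End AtPoint.

Section Smooth.
Variable U : set V.
Hypothesis oU : open U.

Lemma msmooth_mdiff m n (M : V -> 'M[R]_(m, n)) x : msmooth U M -> U x -> mdiff M x.
Proof. by move=> sM Ux i j; exact: smooth_diff (sM i j) Ux. Qed.

Lemma msmooth_cst m n (M : 'M[R]_(m, n)) : msmooth U (fun _ => M).
Proof. by move=> i j; exact: smooth_cst. Qed.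

Lemma msmooth_add m n (M N : V -> 'M[R]_(m, n)) :
  msmooth U M -> msmooth U N -> msmooth U (fun y => M y + N y).
Proof.
move=> sM sN i j; apply: smooth_ext (smooth_add oU (sM i j) (sN i j)) => // x _.
by rewrite mxE.
Qed.

Lemma msmooth_opp m n (M : V -> 'M[R]_(m, n)) :
  msmooth U M -> msmooth U (fun y => - M y).
Proof.
move=> sM i j; apply: smooth_ext (smooth_opp oU (sM i j)) => // x _.
by rewrite mxE.
Qed.

Lemma msmooth_mul m n p (M : V -> 'M[R]_(m, n)) (N : V -> 'M[R]_(n, p)) :
  msmooth U M -> msmooth U N -> msmooth U (fun y => M y *m N y).
Proof.
move=> sM sN i j.
apply: (@smooth_ext _ _ _ oU _ (fun y => \sum_k M y i k * N y k j)).
  by move=> x _; rewrite mxE.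
by apply: smooth_sum => // k; exact: smooth_mul.
Qed.

Lemma msmooth_scale m n (a : R) (M : V -> 'M[R]_(m, n)) :
  msmooth U M -> msmooth U (fun y => a *: M y).
Proof.
move=> sM i j; apply: (@smooth_ext _ _ _ oU _ (fun y => a * M y i j)).
  by move=> x _; rewrite mxE.
by apply: smooth_mul => //; exact: smooth_cst.
Qed.

Lemma msmooth_tr m n (M : V -> 'M[R]_(m, n)) :
  msmooth U M -> msmooth U (fun y => (M y)^T).
Proof. by move=> sM i j; apply: smooth_ext (sM j i) => // x _; rewrite mxE. Qed.

Lemma msmooth_derive m n (M : V -> 'M[R]_(m, n)) v :
  msmooth U M -> msmooth U (fun y => 'D_v M y).
Proof.
move=> sM i j; apply: smooth_ext (smooth_derive v (sM i j)) => // x Ux.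
by rewrite derive_mxE //; exact: msmooth_mdiff Ux.
Qed.

Lemma smooth_det n (M : V -> 'M[R]_n) : msmooth U M -> smooth_on U (fun y => \det (M y)).
Proof.
move=> sM; apply: smooth_sum => // s; apply: smooth_mul => //; first exact: smooth_cst.
by apply: smooth_prod.
Qed.

Lemma msmooth_invmx n (M : V -> 'M[R]_n) :
  (forall x, U x -> M x \in unitmx) -> msmooth U M -> msmooth U (fun y => invmx (M y)).
Proof.
move=> uM sM i j.
(* Cramer's rule: the entries of the inverse are cofactors divided by the determinant. *)
apply: (@smooth_ext _ _ _ oU _ (fun y => (\det (M y))^-1 * cofactor (M y) j i)).
  by move=> x Ux; rewrite /invmx uM // !mxE.
apply: smooth_mul => //.
  apply: smooth_inv => //; last exact: smooth_det.
  by move=> x Ux; rewrite -unitfE -unitmxE uM.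
apply: smooth_mul => //; first exact: smooth_cst.
apply: smooth_det => k l.
by apply: smooth_ext (sM (lift j k) (lift i l)) => // x _; rewrite !mxE.
Qed.

Lemma schwarz_mx m n (M : V -> 'M[R]_(m, n)) x u v : msmooth U M -> U x ->
  'D_v (fun y => 'D_u M y) x = 'D_u (fun y => 'D_v M y) x.
Proof.
move=> sM Ux; apply/matrixP => i j.
have dD w : mdiff (fun y => 'D_w M y) x by exact: msmooth_mdiff (msmooth_derive w sM) Ux.
apply: (etrans (derive_mxE v i j (dD u))).
apply: (etrans _ (esym (derive_mxE u i j (dD v)))).
have nU : \near x, U x by exact: open_nbhs_nbhs.
have E w w' : 'D_w (fun y => 'D_w' M y i j) x = 'D_w (fun y => 'D_w' (fun z => M z i j) y) x.
  apply: near_eq_derive; apply: filterS nU => y Uy.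
  by rewrite derive_mxE //; exact: msmooth_mdiff Uy.
apply: (etrans (E v u)); apply: (etrans _ (esym (E u v))).
exact: schwarz oU (sM i j) Ux.
Qed.

End Smooth.

End MatrixCalculus.

Lemma derive_comp_mx (R : realType) (V W : normedModType R) m n
    (M : W -> 'M[R]_(m, n)) (phi : V -> W) x v :
  differentiable phi x -> mdiff M (phi x) ->
  mdiff (fun y => M (phi y)) x /\
  'D_v (fun y => M (phi y)) x = 'D_('D_v phi x) M (phi x).
Proof.
move=> dphi dM.
have dc : mdiff (fun y => M (phi y)) x.
  by move=> i j; apply: (differentiable_comp dphi (dM i j)).
split; first exact: dc.
apply/matrixP => i j; 
apply: (etrans (derive_mx_diff v i j dc)).
apply: (etrans _ (esym (derive_mx_diff _ i j dM))).
by rewrite (deriveE v dphi) (diff_comp dphi (dM i j)).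
Qed.

(** * Bilinear forms and their Gram matrices *)

Section Gram.
Context {R : realType} {n : nat}.
Notation V := 'rV[R]_n.
Implicit Types (G : 'M[R]_n) (X Y : V).

Lemma gram_basis G X a : gram G X (basis_vec R a) = (X *m G) 0 a.
Proof. by rewrite /gram /basis_vec trmx_delta -colE mxE. Qed.

Lemma row_basis_sum X : X = \sum_a X 0 a *: basis_vec R a.
Proof. exact: row_sum_delta. Qed.

Lemma eq_gram G H : (forall X Y, gram G X Y = gram H X Y) -> G = H.
Proof.
move=> GH; apply/matrixP => a b.
by have := GH (basis_vec R a) (basis_vec R b); rewrite !gram_basis -!rowE !mxE.
Qed.

Lemma gramDl G X X' Y : gram G (X + X') Y = gram G X Y + gram G X' Y.
Proof. by rewrite /gram !mulmxDl mxE. Qed.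
Lemma gramDr G X Y Y' : gram G X (Y + Y') = gram G X Y + gram G X Y'.
Proof. by rewrite /gram linearD mulmxDr mxE. Qed.
Lemma gramZl G a X Y : gram G (a *: X) Y = a * gram G X Y.
Proof. by rewrite /gram -!scalemxAl mxE. Qed.
Lemma gramZr G a X Y : gram G X (a *: Y) = a * gram G X Y.
Proof. by rewrite /gram linearZ -scalemxAr mxE. Qed.
Lemma gramNl G X Y : gram G (- X) Y = - gram G X Y.
Proof. by rewrite /gram !mulNmx mxE. Qed.
Lemma gramNr G X Y : gram G X (- Y) = - gram G X Y.
Proof. by rewrite /gram linearN mulmxN mxE. Qed.
Lemma gram0l G Y : gram G 0 Y = 0.
Proof. by rewrite /gram !mul0mx mxE. Qed.
Lemma gram_tr G X Y : gram G X Y = gram G^T Y X.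
Proof.
have -> : gram G^T Y X = (X *m G *m Y^T)^T 0 0.
  by rewrite /gram !trmx_mul trmxK mulmxA.
by rewrite mxE.
Qed.

Lemma gram_oppmx G X Y : gram (- G) X Y = - gram G X Y.
Proof. by rewrite /gram mulmxN mulNmx mxE. Qed.

Lemma gramC G X Y : G^T = G -> gram G X Y = gram G Y X.
Proof.
by move=> sG; rewrite gram_tr sG.
Qed.

Definition posdef G := G^T = G /\ forall X, X != 0 -> 0 < gram G X X.

Lemma posdef_unit G : posdef G -> G \in unitmx.
Proof.
case=> _ pG; rewrite -row_free_unit -kermx_eq0; apply/negPn/negP => /rowV0Pn[v].
move=> /sub_kermxP vG /pG; by rewrite /gram vG mul0mx mxE ltxx.
Qed.

Lemma linear_functionalE (w : V -> R) X : (forall a X Y, w (a *: X + Y) = a * w X + w Y) ->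
  w X = \sum_a X 0 a * w (basis_vec R a).
Proof.
move=> lw; have w0 : w 0 = 0.
  by have := lw 1 0 0; rewrite scaler0 addr0 mul1r => /esym/eqP; rewrite -subr_eq0 addrK => /eqP.
have wS (r : seq 'I_n) : w (\sum_(a <- r) X 0 a *: basis_vec R a) =
    \sum_(a <- r) X 0 a * w (basis_vec R a).
  by elim: r => [|a r IH]; rewrite ?big_nil // !big_cons lw IH.
by rewrite [in LHS](row_basis_sum X) wS.
Qed.

Lemma gram_sharp G (w : V -> R) W : G \in unitmx ->
  (forall a X Y, w (a *: X + Y) = a * w X + w Y) ->
  gram G (sharp G w) W = w W.
Proof.
move=> uG lw; rewrite /gram /sharp mulmxKV // (linear_functionalE W lw) mxE.
by apply: eq_bigr => a _; rewrite !mxE mulrC.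
Qed.

Lemma gram_inj G X Y : G \in unitmx -> (forall W, gram G X W = gram G Y W) -> X = Y.
Proof.
move=> uG XY; rewrite -[X](mulmxK uG) -[Y](mulmxK uG); congr (_ *m _).
by apply/rowP => a; rewrite -!gram_basis.
Qed.

End Gram.

(** * The Levi-Civita connection and its curvature *)

(** The algebra of [curv_skew]: [P] and [Q] are the connection matrices along X and Y, [a] is the
    derivative of [Q] along X and [b] that of [P] along Y. The hypothesis equates the two mixed
    second derivatives of the metric [g]. *)
Lemma commutator_skew (R : comNzRingType) n (a b P Q g : 'M[R]_n) :
  b *m g + P *m (Q *m g + g *m Q^T) + ((Q *m g + g *m Q^T) *m P^T + g *m b^T) =
  a *m g + Q *m (P *m g + g *m P^T) + ((P *m g + g *m P^T) *m Q^T + g *m a^T) ->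
  (a - b + Q *m P - P *m Q) *m g + g *m (a - b + Q *m P - P *m Q)^T = 0.
Proof.
move/eqP; rewrite eq_sym -subr_eq0 => /eqP <-.
have -> : (a - b + Q *m P - P *m Q)^T = a^T - b^T + P^T *m Q^T - Q^T *m P^T.
  by apply/matrixP => i j; rewrite -!trmx_mul !mxE.
mxabel.
Qed.

Section LeviCivita.
Context {R : realType} {n : nat}.
Notation V := 'rV[R]_n.
Notation e a := (basis_vec R a).

Section Connection.
Variable G : V -> 'M[R]_n.

(** The matrix of the bilinear form sending (Y, W) to the derivative of g(X, W) along Y. *)
Definition dmetric (X : V) (x : V) : 'M[R]_n :=
  \matrix_(a, b) (X *m 'D_(e a) G x) 0 b.

(** The connection form in the coordinate frame, acting on rows from the right: the covariant
    derivative of Y along X is ['D_X Y + Y *m conn X]. The three summands are those of the Koszul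
    formula. *)
Definition conn (X : V) (x : V) : 'M[R]_n :=
  (2^-1 *: ('D_X G x + dmetric X x - (dmetric X x)^T)) *m invmx (G x).

(** Right actions compose in reverse order, hence [conn Y *m conn X] has the plus sign. *)
Definition curv (X Y : V) (x : V) : 'M[R]_n :=
  'D_X (conn Y) x - 'D_Y (conn X) x + conn Y x *m conn X x - conn X x *m conn Y x.

Variable U : set V.
Hypothesis oU : open U.
Hypothesis smG : msmooth U G.
Hypothesis pdG : forall x, U x -> posdef (G x).

Let unitG x : U x -> G x \in unitmx.
Proof. by move=> Ux; exact/posdef_unit/pdG. Qed.

Lemma near_dom x : U x -> \near x, U x.
Proof. by move=> Ux; exact: open_nbhs_nbhs. Qed.

Let dG x : U x -> mdiff G x. Proof. exact: msmooth_mdiff. Qed.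

Lemma derive_metric_sym v x : U x -> ('D_v G x)^T = 'D_v G x.
Proof.
move=> Ux; rewrite -derive_trmx; last exact: dG.
apply: near_eq_derive; apply: filterS (near_dom Ux) => y Uy.
by have [] := pdG Uy.
Qed.

Lemma derive_met X Y v x : U x ->
  'D_v (fun y => met G y X Y) x = gram ('D_v G x) X Y.
Proof.
move=> Ux; rewrite /met /gram.
have dX m (c : 'M[R]_(m, n)) : mdiff (fun y => c *m G y) x.
  by apply: mdiff_mul (dG Ux); exact: mdiff_cst.
have dXY : mdiff (fun y => X *m G y *m Y^T) x.
  by apply: mdiff_mul (dX _ X) _; exact: mdiff_cst.
apply: (etrans (esym (derive_mxE v 0 0 dXY))).
by rewrite (derive_mulr _ _ (dX _ X)) (derive_mull _ _ (dG Ux)).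
Qed.

Lemma dmetric_mul X Y x : U x -> Y *m dmetric X x = X *m 'D_Y G x.
Proof.
move=> Ux; rewrite [in RHS](row_basis_sum Y) derive_dir_sum; last exact: dG.
apply/rowP => b; rewrite mxE mulmx_sumr summxE; apply: eq_bigr => a _.
by rewrite -scalemxAr !mxE.
Qed.

Lemma dmetric_tr_mul X Y a x : (Y *m (dmetric X x)^T) 0 a = gram ('D_(e a) G x) X Y.
Proof. by rewrite /gram !mxE; apply: eq_bigr => b _; rewrite !mxE mulrC. Qed.

Lemma christoffelE X Y x : U x -> christoffel G x X Y = Y *m conn X x.
Proof.
move=> Ux; rewrite /christoffel /sharp /conn mulmxA; congr (_ *m _).
apply/rowP => a; rewrite mxE !derive_met // -scalemxAr mulmxBr mulmxDr dmetric_mul //.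
have := dmetric_tr_mul X Y a x.
move: ('D_X G x) ('D_Y G x) ('D_(e a) G x) (Y *m _) => A B D C <-.
by rewrite !gram_basis !mxE.
Qed.

(** The part [dmetric X - (dmetric X)^T] of the Koszul formula is skew, so adding the transpose
    leaves only the derivative of the metric. *)
Lemma conn_metric X x : U x ->
  conn X x *m G x + G x *m (conn X x)^T = 'D_X G x.
Proof.
move=> Ux; have [sG _] := pdG Ux.
rewrite -{2}sG -trmx_mul /conn mulmxKV ?unitG //.
have := derive_metric_sym X Ux; move: ('D_X G x) (dmetric X x) => A N sA.
by apply/matrixP => i j; move/matrixP/(_ i j): sA; rewrite !mxE => ->; lra.
Qed.

Lemma conn_sym X Y x : U x -> Y *m conn X x = X *m conn Y x.
Proof.
move=> Ux; rewrite /conn !mulmxA; congr (_ *m _).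
rewrite -!scalemxAr; congr (_ *: _).
rewrite !mulmxBr.
rewrite !mulmxDr.
rewrite (dmetric_mul _ _ Ux).
rewrite (dmetric_mul _ _ Ux).
have -> : Y *m (dmetric X x)^T = X *m (dmetric Y x)^T.
  apply/rowP => a; rewrite !dmetric_tr_mul.
  exact: gramC (derive_metric_sym _ Ux).
move: (Y *m 'D_X G x) (X *m 'D_Y G x) => A B.
by rewrite [A + B]addrC.
Qed.

(** The difference of the two connections, with its value lowered by the metric, is a trilinear form
    symmetric in its first two arguments and skew in its last two. Alternating the two symmetries
    gives [c = - c]. *)
Lemma conn_uniq (B : V -> 'M[R]_n) x : U x ->
  (forall X Y, Y *m B X = X *m B Y) ->
  (forall X, B X *m G x + G x *m (B X)^T = 'D_X G x) ->
  forall X, B X = conn X x.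
Proof.
move=> Ux symB metB X; have [sG _] := pdG Ux.
pose c X Y Z := gram ((B X - conn X x) *m G x) Y Z.
have cS X' Y Z : c X' Y Z = c Y X' Z.
  by rewrite /c /gram !mulmxA !mulmxBr symB conn_sym.
have cA X' Y Z : c X' Y Z = - c X' Z Y.
  have : ((B X' - conn X' x) *m G x)^T = - ((B X' - conn X' x) *m G x).
    rewrite trmx_mul sG linearB /= mulmxBr mulmxBl opprB.
    have := metB X'; rewrite -(conn_metric X' Ux) => E.
    apply/eqP; rewrite subr_eq addrAC eq_sym subr_eq addrC [X in _ == X]addrC; apply/eqP.
    by rewrite addrC E addrC.
  by rewrite /c; move: (_ *m _) => C E; rewrite gram_tr E gram_oppmx.
have c0 X' Y Z : c X' Y Z = 0.
  have : c X' Y Z = - c X' Y Z by rewrite {1}cA cS cA cS opprK cA cS; ring.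
  lra.
have : (B X - conn X x) *m G x = 0.
  by apply: eq_gram => Y Z; rewrite -/(c X Y Z) c0 /gram mulmx0 mul0mx mxE.
move=> /(congr1 (mulmx^~ (invmx (G x)))); rewrite mulmxK ?unitG // mul0mx.
by move/eqP; rewrite subr_eq0 => /eqP.
Qed.

(** By [conn_sym], row [a] of [conn X] is the product of [X] with a matrix that does not depend on
    [X]. *)
Lemma connD X Y x : U x -> conn (X + Y) x = conn X x + conn Y x.
Proof.
move=> Ux; apply/row_matrixP => a; rewrite linearD /= !rowE.
by rewrite !(conn_sym _ (delta_mx 0 a) Ux) mulmxDl.
Qed.

Lemma connZ c X x : U x -> conn (c *: X) x = c *: conn X x.
Proof.
move=> Ux; apply/row_matrixP => a; rewrite linearZ /= !rowE.
by rewrite !(conn_sym _ (delta_mx 0 a) Ux) -scalemxAl.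
Qed.

Lemma msmooth_conn X : msmooth U (conn X).
Proof.
have sM : msmooth U (dmetric X).
  move=> a b; apply: (@smooth_ext _ _ _ oU _ (fun x => (X *m 'D_(e a) G x) 0 b)).
    by move=> x _; rewrite [RHS]mxE.
  apply: (@msmooth_mul _ _ _ oU _ _ _ (fun _ => X) (fun x => 'D_(e a) G x)).
    exact: msmooth_cst.
  exact: msmooth_derive.
apply: msmooth_mul => //; last by apply: msmooth_invmx.
apply: msmooth_scale => //; apply: msmooth_add => //; last first.
  by apply: msmooth_opp => //; exact: msmooth_tr.
by apply: msmooth_add => //; exact: msmooth_derive.
Qed.

Let dconn X x : U x -> mdiff (conn X) x.
Proof. by move=> Ux; exact: msmooth_mdiff (msmooth_conn X) Ux. Qed.

Lemma derive_conn_sym X Y v x : U x -> Y *m 'D_v (conn X) x = X *m 'D_v (conn Y) x.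
Proof.
move=> Ux; rewrite -!(derive_mull _ _ (dconn _ Ux)).
apply: near_eq_derive; apply: filterS (near_dom Ux) => y Uy.
by rewrite conn_sym.
Qed.

Lemma Riem13E X Y Z x : U x -> Riem13 G x X Y Z = Z *m curv X Y x.
Proof.
move=> Ux.
have E X' Y' : nabla G (cst X') (nabla G (cst Y') (cst Z)) x =
    Z *m ('D_X' (conn Y') x + conn Y' x *m conn X' x).
  rewrite /nabla /= -/(cst Y') derive_cst add0r !christoffelE // mulmxDr mulmxA.
  congr (_ + _).
  transitivity ('D_X' (fun y => Z *m conn Y' y) x).
    apply: near_eq_derive; apply: filterS (near_dom Ux) => y Uy.
    by rewrite derive_cst add0r christoffelE.
  exact: derive_mull (dconn _ Ux).
rewrite /Riem13 (E X Y) (E Y X) -mulmxBr /curv; congr (_ *m _).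
mxabel.
Qed.

Lemma RiemE X Y Z W x : U x -> Riem G x X Y Z W = gram (curv X Y x *m G x) Z W.
Proof. by move=> Ux; rewrite /Riem Riem13E // /met /gram !mulmxA. Qed.

Lemma curv_anti X Y x : curv X Y x = - curv Y X x.
Proof. rewrite /curv.
mxabel. Qed.

Lemma derive_connD X Y v x : U x ->
  'D_v (conn (X + Y)) x = 'D_v (conn X) x + 'D_v (conn Y) x.
Proof.
move=> Ux; rewrite -derive_addmx; [|exact: dconn..].
by apply: near_eq_derive; apply: filterS (near_dom Ux) => y Uy; rewrite connD.
Qed.

Lemma derive_connZ c X v x : U x ->
  'D_v (conn (c *: X)) x = c *: 'D_v (conn X) x.
Proof.
move=> Ux; rewrite -deriveZ; last exact: mdiff_derivable (dconn _ Ux).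
by apply: near_eq_derive; apply: filterS (near_dom Ux) => y Uy; rewrite connZ.
Qed.

Lemma curvDl X X' Y x : U x -> curv (X + X') Y x = curv X Y x + curv X' Y x.
Proof.
move=> Ux; rewrite /curv (derive_dirD X X' (dconn Y Ux)) (derive_connD X X' Y Ux).
rewrite (connD X X' Ux).
mxabel.
Qed.

Lemma curvZl c X Y x : U x -> curv (c *: X) Y x = c *: curv X Y x.
Proof.
move=> Ux; rewrite /curv (derive_dirZ c X (dconn Y Ux)) (derive_connZ c X Y Ux).
rewrite (connZ c X Ux).
by rewrite -scalemxAl -scalemxAr !(scalerDr, scalerN).
Qed.

Lemma curvZr c X Y x : U x -> curv X (c *: Y) x = c *: curv X Y x.
Proof. by move=> Ux; rewrite ![curv X _ _]curv_anti curvZl // scalerN. Qed.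

Lemma curv_bianchi1 X Y Z x : U x ->
  Z *m curv X Y x + X *m curv Y Z x + Y *m curv Z X x = 0.
Proof.
move=> Ux.
have E X' Y' Z' := derive_conn_sym Y' Z' X' Ux.
rewrite /curv; move: (E X Y Z) (E Y Z X) (E Z X Y).
move: (conn_sym Y Z Ux) (conn_sym X Z Ux) (conn_sym X Y Ux).
move: ('D_X (conn Y) x) ('D_Y (conn X) x) ('D_Y (conn Z) x) ('D_Z (conn Y) x).
move: ('D_Z (conn X) x) ('D_X (conn Z) x) (conn X x) (conn Y x) (conn Z x).
move=> ZX XZ AX AY AZ XY YX YZ ZY cYZ cXZ cXY E1 E2 E3.
rewrite !(mulmxDr, mulmxN, mulmxBr) !mulmxA E1 E2 E3 cYZ cXZ cXY.
mxabel.
Qed.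

(* Differentiate [conn_metric] twice and antisymmetrise: the second derivatives of [G] cancel. *)
Lemma curv_skew X Y x : U x -> curv X Y x *m G x + G x *m (curv X Y x)^T = 0.
Proof.
move=> Ux; have [sG _] := pdG Ux.
have E v w : 'D_v (fun y => 'D_w G y) x =
    'D_v (conn w) x *m G x + conn w x *m 'D_v G x
    + ('D_v G x *m (conn w x)^T + G x *m ('D_v (conn w) x)^T).
  transitivity ('D_v (fun y => conn w y *m G y + G y *m (conn w y)^T) x).
    by apply: near_eq_derive; apply: filterS (near_dom Ux) => y Uy; rewrite conn_metric.
  have dT : mdiff (fun y => (conn w y)^T) x by apply/mdiff_tr/dconn.
  have dl := mdiff_mul (dconn w Ux) (dG Ux); have dr := mdiff_mul (dG Ux) dT.
  rewrite (derive_addmx v dl dr) (derive_mulmx v (dconn w Ux) (dG Ux)).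
  by rewrite (derive_mulmx v (dG Ux) dT) (derive_trmx v (dconn w Ux)).
have := schwarz_mx oU X Y smG Ux.
move=> S; move: (etrans (etrans (esym (E Y X)) S) (E X Y)) => {E S}.
rewrite -(conn_metric X Ux) -(conn_metric Y Ux).
exact: commutator_skew.
Qed.

Lemma mdiff_curv X Y x : U x -> mdiff (curv X Y) x.
Proof.
move=> Ux; suff sc : msmooth U (curv X Y) by exact: msmooth_mdiff sc Ux.
apply: msmooth_add => //; last first.
  by apply: msmooth_opp => //; apply: msmooth_mul => //; exact: msmooth_conn.
apply: msmooth_add => //; last by apply: msmooth_mul => //; exact: msmooth_conn.
apply: msmooth_add => //; first exact: msmooth_derive (msmooth_conn _).
by apply: msmooth_opp => //; exact: msmooth_derive (msmooth_conn _).
Qed.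

(** [D] is the covariant derivative of the endomorphism [curv A B] for constant [A] and [B].
    Expanding it leaves second derivatives of the connection matrices, which cancel by Schwarz's
    theorem, and products, which cancel in the cyclic sum. *)
Lemma curv_bianchi2 X Y Z x : U x ->
  let D W A B := 'D_W (curv A B) x + curv A B x *m conn W x - conn W x *m curv A B x in
  D X Y Z + D Y Z X + D Z X Y = 0.
Proof.
move=> Ux /=.
have dD v w : mdiff (fun y => 'D_v (conn w) y) x.
  exact: msmooth_mdiff (msmooth_derive oU v (msmooth_conn w)) Ux.
have dO (A : V -> 'M[R]_n) : mdiff A x -> mdiff (fun y => - A y) x.
  move=> dA i j; rewrite (_ : (fun y => _) = - (fun y => A y i j)).
    exact: differentiableN.
  by apply/funext => y; rewrite mxE.
have dM v w : mdiff (fun y => conn v y *m conn w y) x.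
  by apply: mdiff_mul; exact: dconn.
pose D1 v w := 'D_v (conn w) x; pose D2 v w c := 'D_v (fun y => 'D_w (conn c) y) x.
pose DC W A B := 'D_W (curv A B) x.
have E W A B : DC W A B = D2 W A B - D2 W B A
    + (D1 W B *m conn A x + conn B x *m D1 W A)
    - (D1 W A *m conn B x + conn A x *m D1 W B).
  have d1 := mdiff_add (dD A B) (dO _ (dD B A)); have d2 := mdiff_add d1 (dM B A).
  apply: (etrans (derive_addmx W d2 (dO _ (dM A B)))).
  rewrite (derive_addmx W d1 (dM B A)) (derive_addmx W (dD A B) (dO _ (dD B A))).
  rewrite (derive_oppmx W (dM A B)) (derive_oppmx W (dD B A)).
  by rewrite !(derive_mulmx W (dconn _ Ux) (dconn _ Ux)).
have S v w c : D2 v w c = D2 w v c.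
  by have := schwarz_mx oU w v (msmooth_conn c) Ux; apply.
have cE A B : curv A B x = D1 A B - D1 B A + conn B x *m conn A x - conn A x *m conn B x.
  by [].
suff : DC X Y Z + curv Y Z x *m conn X x - conn X x *m curv Y Z x
    + (DC Y Z X + curv Z X x *m conn Y x - conn Y x *m curv Z X x)
    + (DC Z X Y + curv X Y x *m conn Z x - conn Z x *m curv X Y x) = 0 by [].
clearbody D1 D2 DC.
rewrite !E !cE (S Y X Z) (S Z Y X) (S X Z Y).
mxabel.
Qed.

End Connection.
End LeviCivita.

(** * Change of charts *)

(** The last two hypotheses are the transformation law of a connection under a change of frame [J],
    the first two its derivatives. Subtracting these removes the second derivatives [DD] of [J] and
    the symmetric term [s]. *)
Lemma curv_gauge_algebra (R : comNzRingType) n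
    (J AX AY fX fY DXAY DYAX DXJ DYJ DD cXY cYX s : 'M[R]_n) :
  DXAY *m J + AY *m DXJ = DD + (DXJ *m fY + J *m (cXY + s)) ->
  DYAX *m J + AX *m DYJ = DD + (DYJ *m fX + J *m (cYX + s)) ->
  AX *m J = DXJ + J *m fX -> AY *m J = DYJ + J *m fY ->
  (DXAY - DYAX + AY *m AX - AX *m AY) *m J =
  J *m (cXY - cYX + fY *m fX - fX *m fY).
Proof.
move=> /(canRL (addrK _)) h1 /(canRL (addrK _)) h2 l1 l2.
rewrite mulmxBl mulmxDl mulmxBl h1 h2 -!mulmxA l1 l2 !mulmxDr !mulmxA l1 l2.
mxabel.
Qed.

Section ChangeOfCharts.
Context {R : realType} {n : nat}.
Notation V := 'rV[R]_n.
Variables (G H : V -> 'M[R]_n) (U U' W : set V) (phi : V -> V).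
Hypotheses (oU : open U) (oU' : open U') (oW : open W).
Hypotheses (smG : msmooth U G) (smH : msmooth U' H).
Hypotheses (pdG : forall x, U x -> posdef (G x)) (pdH : forall x, U' x -> posdef (H x)).
Hypotheses (WU : forall x, W x -> U x) (WU' : forall x, W x -> U' (phi x)).
Hypothesis smphi : smooth_on W phi.
Hypothesis isom : forall x X Y, W x ->
  gram (G x) X Y = gram (H (phi x)) ('d phi x X) ('d phi x Y).

Let J x := jacobian phi x.

Let dphi x : W x -> differentiable phi x. Proof. exact: smooth_diff smphi. Qed.

Let derive_phi X x : W x -> 'D_X phi x = X *m J x.
Proof. by move=> Wx; exact: deriveEjacobian (dphi Wx). Qed.

Lemma mul_jacobian X x : W x -> X *m J x = 'd phi x X.
Proof. by move=> Wx; rewrite -derive_phi // deriveE //; exact: dphi. Qed.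

Let msmooth_phi : msmooth W phi.
Proof. by move=> i j; exact: smooth_coord. Qed.

Let msmooth_J : msmooth W J.
Proof.
move=> a b; apply: (@smooth_ext _ _ _ oW _ (fun x => ('D_(basis_vec R a) phi x) 0 b)).
  by move=> x Wx; rewrite derive_phi // -rowE mxE.
exact: msmooth_derive msmooth_phi 0 b.
Qed.

Let dJ x : W x -> mdiff J x. Proof. exact: msmooth_mdiff. Qed.

Let G_pullback x : W x -> G x = J x *m H (phi x) *m (J x)^T.
Proof.
move=> Wx; apply: eq_gram => X Y; rewrite isom // -!mul_jacobian //.
by rewrite /gram trmx_mul !mulmxA.
Qed.

Let unitJ x : W x -> J x \in unitmx.
Proof.
move=> Wx; have := posdef_unit (pdG (WU Wx)).
by rewrite G_pullback // !unitmx_mul => /andP[/andP[]].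
Qed.

(** Both sides are second derivatives of [phi] along [X] and [Y]. *)
Let derive_J_sym X Y x : W x -> Y *m 'D_X J x = X *m 'D_Y J x.
Proof.
move=> Wx.
have E v w : w *m 'D_v J x = 'D_v (fun y => 'D_w phi y) x.
  rewrite -(derive_mull _ _ (dJ Wx)); apply: near_eq_derive.
  by apply: filterS (near_dom oW Wx) => y Wy; rewrite derive_phi.
apply: (etrans (E X Y)); apply: (etrans _ (esym (E Y X))).
exact: (schwarz_mx oW Y X msmooth_phi Wx).
Qed.

Let comp_phi (M : V -> 'M[R]_n) v x : msmooth U' M -> W x ->
  mdiff (fun y => M (phi y)) x /\
  'D_v (fun y => M (phi y)) x = 'D_(v *m J x) M (phi x).
Proof.
move=> sM Wx; rewrite -(derive_phi v Wx).
by apply: derive_comp_mx; [exact: dphi|apply: msmooth_mdiff sM _; exact: WU'].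
Qed.

(* The right-hand side defines a torsion-free metric connection for [G], so [conn_uniq] applies. *)
Lemma conn_change X x : W x ->
  conn G X x *m J x = 'D_X J x + J x *m conn H (X *m J x) (phi x).
Proof.
move=> Wx; have Ux := WU Wx; have U'x := WU' Wx.
pose B X := ('D_X J x + J x *m conn H (X *m J x) (phi x)) *m invmx (J x).
suff <- : B X = conn G X x by rewrite /B mulmxKV // unitJ.
move: X; apply: (conn_uniq oU smG pdG Ux) => [X Y|X].
  rewrite /B.
  rewrite (mulmxA Y) (mulmxA X).
  apply: (congr1 (mulmx^~ (invmx (J x)))).
  have := conn_sym oU' smH pdH (X *m J x) (Y *m J x) U'x; have := derive_J_sym X Y Wx.
  move: (conn H (X *m J x) (phi x)) (conn H (Y *m J x) (phi x)).
  move: ('D_X J x) ('D_Y J x) => d1 d2 c1 c2 dE cE.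
  by rewrite !mulmxDr !mulmxA dE cE.
have -> : 'D_X G x = 'D_X (fun y => J y *m H (phi y) *m (J y)^T) x.
  apply: near_eq_derive; apply: filterS (near_dom oW Wx) => y Wy.
  exact: G_pullback.
have [dH DH] := comp_phi X smH Wx.
have dJT := mdiff_tr (dJ Wx); have dJH := mdiff_mul (dJ Wx) dH.
rewrite (derive_mulmx X dJH dJT) (derive_mulmx X (dJ Wx) dH) DH.
rewrite (derive_trmx X (dJ Wx)) -(conn_metric oU' smH pdH _ U'x).
have [sH _] := pdH U'x.
have -> : B X *m G x = ('D_X J x + J x *m conn H (X *m J x) (phi x)) *m H (phi x) *m (J x)^T.
  by rewrite /B G_pullback // !mulmxA mulmxKV // unitJ.
have -> : G x *m (B X)^T =
    J x *m H (phi x) *m ('D_X J x + J x *m conn H (X *m J x) (phi x))^T.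
  have [sG _] := pdG Ux; rewrite -sG -trmx_mul /B [X in _ *m X]G_pullback //.
  by rewrite !mulmxA mulmxKV ?unitJ // !trmx_mul trmxK sH !mulmxA.
move: ('D_X J x) (H (phi x)) (J x) (conn H (X *m J x) (phi x)) => d h j c.
have -> : (d + j *m c)^T = d^T + c^T *m j^T.
  by apply/matrixP => i k; rewrite -trmx_mul !mxE.
mxabel.
Qed.

Let F (X y : V) := conn H (X *m J y) (phi y).

(** [F X y] depends on [y] through the direction [X *m J y] as well as through the point [phi y].
    Torsion-freeness turns the direction into a factor and leaves [conn H Z] with [Z] fixed, to
    which the chain rule applies. *)
Let F_row X Z y : W y -> Z *m F X y = X *m J y *m conn H Z (phi y).
Proof. by move=> Wy; exact: (conn_sym oU' smH pdH _ _ (WU' Wy)). Qed.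

Let mdiff_rowF X Z x : W x ->
  @mdiff _ _ 1 n (fun y => X *m J y *m conn H Z (phi y)) x.
Proof.
move=> Wx; have [dC _] := comp_phi 0 (msmooth_conn oU' smH pdH Z) Wx.
by apply: mdiff_mul dC; apply: mdiff_mul (dJ Wx); exact: mdiff_cst.
Qed.

Let mdiff_F X x : W x -> mdiff (F X) x.
Proof.
move=> Wx i j.
apply: near_eq_differentiable (mdiff_rowF X (delta_mx 0 i) Wx 0 j).
apply: filterS (near_dom oW Wx) => y Wy.
by rewrite -F_row // -rowE mxE.
Qed.

Let derive_F X Y x : W x -> 'D_Y (F X) x =
  'D_(Y *m J x) (conn H (X *m J x)) (phi x) + conn H (X *m 'D_Y J x) (phi x).
Proof.
move=> Wx; have U'x := WU' Wx; apply/row_matrixP => i; rewrite linearD /= !rowE.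
move: (delta_mx 0 i) => Z.
rewrite -(derive_mull _ _ (mdiff_F X Wx)).
transitivity ('D_Y (fun y => X *m J y *m conn H Z (phi y)) x).
  by apply: near_eq_derive; apply: filterS (near_dom oW Wx) => y Wy; rewrite F_row.
have [dC DC] := comp_phi Y (msmooth_conn oU' smH pdH Z) Wx.
have dXJ : @mdiff _ _ 1 n (fun y => X *m J y) x by apply: mdiff_mul (dJ Wx); exact: mdiff_cst.
rewrite (derive_mulmx Y dXJ dC) DC (derive_mull _ _ (dJ Wx)) addrC.
rewrite (derive_conn_sym oU' smH pdH (X *m J x) Z _ U'x).
by congr (_ + _); exact: (conn_sym oU' smH pdH _ _ U'x).
Qed.

Lemma curv_change X Y x : W x ->
  curv G X Y x *m J x = J x *m curv H (X *m J x) (Y *m J x) (phi x).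
Proof.
move=> Wx; have Ux := WU Wx; have U'x := WU' Wx.
have dA Z : mdiff (conn G Z) x by exact: msmooth_mdiff (msmooth_conn oU smG pdG Z) Ux.
have E v w : 'D_v (conn G w) x *m J x + conn G w x *m 'D_v J x =
    'D_v (fun y => 'D_w J y) x + ('D_v J x *m F w x + J x *m 'D_v (F w) x).
  rewrite -(derive_mulmx v (dA w) (dJ Wx)) -(derive_mulmx v (dJ Wx) (mdiff_F w Wx)).
  have dd : mdiff (fun y => 'D_w J y) x.
    exact: msmooth_mdiff (msmooth_derive oW w msmooth_J) Wx.
  rewrite -(derive_addmx v dd (mdiff_mul (dJ Wx) (mdiff_F w Wx))).
  apply: near_eq_derive; apply: filterS (near_dom oW Wx) => y Wy.
  exact: conn_change.
have EX := E X Y; have EY := E Y X.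
rewrite derive_F // in EX; rewrite derive_F // in EY.
rewrite (schwarz_mx oW X Y msmooth_J Wx) (derive_J_sym Y X Wx) in EY.
exact: curv_gauge_algebra EX EY (conn_change X Wx) (conn_change Y Wx).
Qed.

Lemma Riem_change x X1 X2 X3 X4 : W x ->
  Riem G x X1 X2 X3 X4 =
  Riem H (phi x) ('d phi x X1) ('d phi x X2) ('d phi x X3) ('d phi x X4).
Proof.
move=> Wx; rewrite (RiemE oU smG pdG) ?(RiemE oU' smH pdH); [|exact: WU'|exact: WU].
rewrite -!mul_jacobian // G_pullback // /gram !mulmxA.
by rewrite -(mulmxA X3) curv_change // trmx_mul !mulmxA.
Qed.

End ChangeOfCharts.

(** * Schur's lemma *)

Section GramDeterminant.
Context {R : realType} {n : nat}.
Notation V := 'rV[R]_n.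
Implicit Types (G : 'M[R]_n) (X Y : V).

Definition gramdet G X Y := gram G X X * gram G Y Y - gram G X Y ^+ 2.

Lemma row_free_pair X Y a b : row_free (col_mx X Y) -> a *: X + b *: Y = 0 -> a = 0 /\ b = 0.
Proof.
move=> fr ab0; have : row_mx a%:M b%:M *m col_mx X Y = 0.
  by rewrite mul_row_col !mul_scalar_mx.
rewrite -[RHS](mul0mx _ (col_mx X Y)) => /(row_free_inj fr).
rewrite -row_mx0 => /eq_row_mx[/matrixP/(_ 0 0) + /matrixP/(_ 0 0)].
by rewrite !mxE /= !mulr1n.
Qed.

Lemma gramdet_gt0 G X Y : posdef G -> row_free (col_mx X Y) -> 0 < gramdet G X Y.
Proof.
move=> [sG pG] fr; have X0 : X != 0.
  apply/eqP => X0; have [] := @row_free_pair X Y 1 0 fr; last by lra.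
  by rewrite X0 scaler0 scale0r addr0.
have XX := pG _ X0.
(* The square norm of this vector is [gram G X X * gramdet G X Y]. *)
have /pG : gram G X X *: Y - gram G X Y *: X != 0.
  apply/eqP; rewrite addrC -scaleNr => /(row_free_pair fr)[_].
  by move/eqP; rewrite gt_eqF.
rewrite !(gramDl, gramDr, gramNl, gramNr, gramZl, gramZr) (gramC Y X sG) => H.
have : 0 < gram G X X * gramdet G X Y 
  by rewrite /gramdet; lra.
by rewrite pmulr_rgt0.
Qed.

Lemma row_free_basis (a b : 'I_n) : a != b ->
  row_free (col_mx (basis_vec R a) (basis_vec R b)).
Proof.
move=> ab; rewrite -kermx_eq0; apply/negPn/negP => /rowV0Pn[v /sub_kermxP].
rewrite -[v]hsubmxK mul_row_col => /rowP E /eqP; apply.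
rewrite -row_mx0; congr row_mx; apply/matrixP => i j; rewrite !ord1.
  by have := E a; rewrite !mxE !big_ord1 !mxE !eqxx (negPf ab) mulr1 mulr0 addr0.
by have := E b; rewrite !mxE !big_ord1 !mxE !eqxx eq_sym (negPf ab) mulr1 mulr0 add0r.
Qed.

Lemma exists_two_others (a : 'I_n) : (3 <= n)%N ->
  exists b c : 'I_n, [/\ a != b, a != c & b != c].
Proof.
move=> n3; have /card_gt1P[b [c [ba ca bc]]] : (1 < #|predC1 a|)%N.
  by rewrite cardC1 card_ord; lia.
move: ba ca; rewrite !inE => ba ca.
by exists b, c; rewrite eq_sym ba eq_sym ca.
Qed.

End GramDeterminant.

Section ScaleRule.
Context {R : realType} {V : normedModType R}.

Lemma derive_scalemx m n (c : V -> R) (M : V -> 'M[R]_(m, n)) x v :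
  differentiable c x -> mdiff M x ->
  'D_v (fun y => c y *: M y) x = 'D_v c x *: M x + c x *: 'D_v M x.
Proof.
move=> dc dM.
have dcM : mdiff (fun y => c y *: M y) x.
  move=> i j; rewrite (_ : (fun y => _) = c * (fun y => M y i j)).
    exact: differentiableM.
  by apply/funext => y; rewrite mxE.
apply/matrixP => i j; apply: (etrans (derive_mxE _ _ _ dcM)).
rewrite (_ : (fun y => _) = c * (fun y => M y i j)); last first.
  by apply/funext => y; rewrite mxE.
rewrite (deriveM (diff_derivable dc) (diff_derivable (dM i j))).
rewrite [RHS]mxE [X in _ = X + _]mxE [X in _ = _ + X]mxE (derive_mxE v i j dM).
by rewrite addrC; congr (_ + _); exact: mulrC.
Qed.

End ScaleRule.

(** The algebra of Schur's lemma. [A], [B], [C] are the connection matrices along X, Y, Z, and [dX],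
    [dY], [dZ] the derivatives of the factor [k]. [D dX A (w Y Z)] is the covariant derivative of
    [k *: (g *m w Y Z)] along X, with the derivative of [g] written as [A *m g + g *m A^T]. *)
Lemma bianchi_rank1 (R : comNzRingType) n (g A B C : 'M[R]_n) (X Y Z : 'rV[R]_n)
    (k dX dY dZ : R) :
  let w (X Y : 'rV[R]_n) := Y^T *m X - X^T *m Y in
  let D d (A M : 'M[R]_n) := d *: (g *m M) + k *: ((A *m g + g *m A^T) *m M)
    + k *: (g *m M) *m A - A *m (k *: (g *m M)) in
  Z *m B = Y *m C -> Z *m A = X *m C -> Y *m A = X *m B ->
  g *m (dX *: w Y Z + dY *: w Z X + dZ *: w X Y) =
  D dX A (w Y Z) + D dY B (w Z X) + D dZ C (w X Y).
Proof.
move=> w D hYZ hXZ hXY.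
(* Torsion-freeness and its transpose, with a prefix [P] so that they rewrite inside products
   associated to the left. *)
have r1 (P : 'M_(n, 1)) : P *m Z *m B = P *m Y *m C by rewrite -!mulmxA hYZ.
have r2 (P : 'M_(n, 1)) : P *m Z *m A = P *m X *m C by rewrite -!mulmxA hXZ.
have r3 (P : 'M_(n, 1)) : P *m Y *m A = P *m X *m B by rewrite -!mulmxA hXY.
have t1 (P : 'M_n) : P *m B^T *m Z^T = P *m C^T *m Y^T by rewrite -!mulmxA -!trmx_mul hYZ.
have t2 (P : 'M_n) : P *m A^T *m Z^T = P *m C^T *m X^T by rewrite -!mulmxA -!trmx_mul hXZ.
have t3 (P : 'M_n) : P *m A^T *m Y^T = P *m B^T *m X^T by rewrite -!mulmxA -!trmx_mul hXY.
rewrite /w /D -?(scalemxAl, scalemxAr) !(mulmxDr, mulmxDl, mulmxN, mulNmx).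
rewrite -?(scalemxAl, scalemxAr) !(mulmxDr, mulmxN) !mulmxA.
rewrite !r1 !r2 !r3 !t1 !t2 !t3.
mxabel.
Qed.

Section Schur.
Context {R : realType} {n : nat}.
Notation V := 'rV[R]_n.
Notation e a := (basis_vec R a).
Variables (G : V -> 'M[R]_n) (U : set V) (K : V -> R).
Hypotheses (n3 : (3 <= n)%N) (oU : open U) (smG : msmooth U G).
Hypothesis pdG : forall x, U x -> posdef (G x).
Hypothesis RK : forall x X1 X2 X3 X4, U x -> Riem G x X1 X2 X3 X4 =
  K x * (met G x X1 X4 * met G x X2 X3 - met G x X1 X3 * met G x X2 X4).

(** On rows, [G x *m wedge X Y] is the endomorphism sending Z to g(Y, Z) X - g(X, Z) Y. *)
Let wedge (X Y : V) : 'M[R]_n := Y^T *m X - X^T *m Y.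

Let curvK X Y x : U x -> curv G X Y x = K x *: (G x *m wedge X Y).
Proof.
move=> Ux; have uG := posdef_unit (pdG Ux).
rewrite -[LHS](mulmxK uG) -[RHS](mulmxK uG); congr (_ *m _).
apply: eq_gram => Z W; rewrite -(RiemE oU smG pdG) // RK //.
have rk1 A B : gram (G x *m (A^T *m B) *m G x) Z W = met G x Z A * met G x B W.
  have -> : gram (G x *m (A^T *m B) *m G x) Z W =
      ((Z *m G x *m A^T) *m (B *m G x *m W^T)) 0 0 by rewrite /gram !mulmxA.
  by rewrite mxE big_ord1.
rewrite /wedge -scalemxAl mulmxBr mulmxBl.
have -> A B c : gram (c *: (A - B)) Z W = c * (gram A Z W - gram B Z W).
  by rewrite /gram -scalemxAr -scalemxAl mulmxBr mulmxBl !mxE.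
rewrite !rk1; have [sG _] := pdG Ux.
by rewrite /met (gramC Z X sG) (gramC Z Y sG); ring.
Qed.

(** No regularity of [K] is given; it is recovered as the sectional curvature of a coordinate plane,
    a quotient of differentiable functions. *)
Let diffK x : U x -> differentiable K x.
Proof.
move=> Ux; pose a : 'I_n := Ordinal (leq_trans (isT : (0 < 3)%N) n3).
have [b [c [ab _ _]]] := exists_two_others a n3.
have d0 y : U y -> gramdet (G y) (e a) (e b) != 0.
  by move=> Uy; rewrite gt_eqF //; apply: gramdet_gt0 (pdG Uy) (row_free_basis ab).
have dgram (M : V -> 'M[R]_n) X Y : mdiff M x -> differentiable (fun y => gram (M y) X Y) x.
  move=> dM; have : @mdiff _ _ 1 1 (fun y => X *m M y *m Y^T) x.
    by do 2?apply: mdiff_mul => //; exact: mdiff_cst.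
  exact.
have dG := msmooth_mdiff smG Ux.
have dN : differentiable (fun y => gram (curv G (e a) (e b) y *m G y) (e b) (e a)) x.
  by apply: dgram; apply: mdiff_mul => //; exact: (mdiff_curv oU smG pdG).
have dD : differentiable (fun y => gramdet (G y) (e a) (e b)) x.
  apply: differentiableB; first by apply: differentiableM; exact: dgram.
  exact: differentiableM (dgram G _ _ dG) (dgram G _ _ dG).
apply: (near_eq_differentiable _ (differentiableM dN (differentiableV dD (d0 x Ux)))).
apply: filterS (near_dom oU Ux) => y Uy.
suff -> : K y = gram (curv G (e a) (e b) y *m G y) (e b) (e a) / gramdet (G y) (e a) (e b) by [].
rewrite -(RiemE oU smG pdG) // RK //.
have [sG _] := pdG Uy; have := d0 y Uy.
by rewrite /gramdet /met (gramC (e b) (e a) sG) -expr2 => d; rewrite mulfK.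
Qed.

(* The second Bianchi identity, where all terms involving the connection cancel. *)
Lemma schur_derive0 x (v : V) : U x -> differentiable K x /\ 'D_v K x = 0.
Proof.
move=> Ux; have dK := diffK Ux; split=> //.
have dG := msmooth_mdiff smG Ux.
have E W X Y : 'D_W (curv G X Y) x = 'D_W K x *: (G x *m wedge X Y)
     + K x *: ((conn G W x *m G x + G x *m (conn G W x)^T) *m wedge X Y).
  rewrite (conn_metric oU smG pdG W Ux).
  have dGw : mdiff (fun y => G y *m wedge X Y) x by apply: mdiff_mul => //; exact: mdiff_cst.
  rewrite -(derive_mulr (wedge X Y) W dG) -(derive_scalemx W dK dGw).
  by apply: near_eq_derive; apply: filterS (near_dom oU Ux) => y Uy; rewrite curvK.
have cyc X Y Z : 'D_X K x *: wedge Y Z + 'D_Y K x *: wedge Z X + 'D_Z K x *: wedge X Y = 0.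
  have /= := curv_bianchi2 oU smG pdG X Y Z Ux.
  rewrite !E !curvK //.
  have := conn_sym oU smG pdG X Y Ux; have := conn_sym oU smG pdG X Z Ux.
  have := conn_sym oU smG pdG Y Z Ux.
  move: ('D_X K x) ('D_Y K x) ('D_Z K x) (conn G X x) (conn G Y x) (conn G Z x) (K x).
  move=> dX dY dZ A B C k.
  move=> hYZ hXZ hXY H.
  have uG := posdef_unit (pdG Ux); apply: (can_inj (mulKmx uG)); rewrite mulmx0 -H.
  exact: bianchi_rank1.
have basis a : 'D_(e a) K x = 0.
  have [b [c [ab ac bc]]] := exists_two_others a n3.
  (* For distinct [a], [b], [c], the entry (c, b) is 1 in [wedge (e b) (e c)] and 0 in the other two
     terms, which isolates the derivative along [e a]. *)
  have /matrixP/(_ c b) := cyc (e a) (e b) (e c).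
  have wE (p q r s : 'I_n) : wedge (e p) (e q) r s =
      ((q == r) && (p == s))%:R - ((p == r) && (q == s))%:R.
    rewrite /wedge /basis_vec !trmx_delta !mul_delta_mx !mxE.
    by rewrite ![r == _]eq_sym ![s == _]eq_sym.
  have sumE (P Q S : 'M[R]_n) (p q s : R) :
      (p *: P + q *: Q + s *: S) c b = p * P c b + q * Q c b + s * S c b by rewrite !mxE.
  rewrite sumE !wE [RHS]mxE !eqxx [b == c]eq_sym (negPf ab) (negPf ac).
  by move: bc; rewrite eq_sym => /negPf ->; rewrite /= !(subr0, mulr0, addr0, mulr1).
rewrite deriveE //; apply: (etrans (congr1 ('d K x) (row_basis_sum v))).
rewrite linear_sum big1 // => a _.
by rewrite linearZ /= -deriveE // basis scaler0.
Qed.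

End Schur.

(** * From the charts to the connected manifold *)

Definition overlap (R : realType) (n : nat) (M : smoothManifold R n) (i j : chart_index M) :=
  chart_cod i `&` chart_inv i @^-1` chart_dom j.

Section ManifoldFields.
Context {R : realType} {n : nat}.
Variable M : smoothManifold R n.
Implicit Types (i j : chart_index M).

Lemma chart_cover (p : M) : exists i, chart_dom i p.
Proof. by case: M p. Qed.

Lemma open_dom i : open (chart_dom i).
Proof. by case: M i. Qed.

Lemma open_cod i : open (chart_cod i).
Proof. by case: M i. Qed.

Lemma chart_mapK i p : chart_dom i p ->
  chart_cod i (chart_map i p) /\ chart_inv i (chart_map i p) = p.
Proof. by case: M i p => /= ? ? ? ? ? ? ? ? ? ? ? H ? ? ? ? i p; exact: H. Qed.

Lemma chart_map_continuous i p : chart_dom i p -> {for p, continuous (chart_map i)}.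
Proof. by case: M i p => /= ? ? ? ? ? ? ? ? ? ? ? ? ? H ? ? i p; exact: H. Qed.

Lemma chart_inv_continuous i x : chart_cod i x -> {for x, continuous (chart_inv i)}.
Proof. by case: M i x => /= ? ? ? ? ? ? ? ? ? ? ? ? ? ? H ? i x; exact: H. Qed.

Lemma smooth_transition i j : smooth_on (overlap i j) (chart_map j \o chart_inv i).
Proof. by case: M i j => /= ? ? ? ? ? ? ? ? ? ? ? ? ? ? ? H i j; exact: H. Qed.

Lemma open_overlap i j : open (overlap i j).
Proof.
rewrite openE => x [cx dx]; apply: filterI.
  by apply: open_nbhs_nbhs; split=> //; exact: open_cod.
by apply: (chart_inv_continuous cx); apply: open_nbhs_nbhs; split=> //; exact: open_dom.
Qed.

End ManifoldFields.

Section RiemannianFields.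
Context {R : realType} {n : nat}.
Variable M : riemannianManifold R n.
Implicit Types (i j : chart_index M).

Lemma metric_smooth i : msmooth (chart_cod i) (metric i).
Proof. by case: M i => /= N g H1 H2 H3 H4 i a b; exact: H1. Qed.

Lemma metric_posdef i x : chart_cod i x -> posdef (metric i x).
Proof.
by case: M i x => /= N g H1 H2 H3 H4 i x cx; split=> [|X]; [exact: H2|exact: H3].
Qed.

Lemma metric_change i j x X Y : overlap i j x ->
  let phi := chart_map j \o chart_inv i in
  gram (metric i x) X Y = gram (metric j (phi x)) ('d phi x X) ('d phi x Y).
Proof. by case: M i j x => /= N g H1 H2 H3 H4 i j x [cx dx]; exact: H4. Qed.

Lemma Riem_chart_change i j x X1 X2 X3 X4 : overlap i j x ->
  let phi := chart_map j \o chart_inv i in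
  Riem (metric i) x X1 X2 X3 X4 =
  Riem (metric j) (phi x) ('d phi x X1) ('d phi x X2) ('d phi x X3) ('d phi x X4).
Proof.
move=> ox phi.
have W1 y : overlap i j y -> chart_cod i y by case.
have W2 y : overlap i j y -> chart_cod j ((chart_map j \o chart_inv i) y).
  by case=> _ dy; have [] := chart_mapK dy.
have := (Riem_change (@open_cod _ _ M i) (@open_cod _ _ M j) (@open_overlap _ _ M i j)
  (metric_smooth i) (metric_smooth j) (@metric_posdef i) (@metric_posdef j) W1 W2
  (smooth_transition i j) (fun y X Y => @metric_change i j y X Y) X1 X2 X3 X4 ox).
by [].
Qed.

Hypothesis n3 : (3 <= n)%N.
Hypothesis pcc : everywhere (M := M) (fun G x _ => exists k, forall X1 X2 X3 X4,
  Riem G x X1 X2 X3 X4 =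
  k * (met G x X1 X4 * met G x X2 X3 - met G x X1 X3 * met G x X2 X4)).
Hypothesis M_connected : connected [set: M].

Let a : 'I_n := Ordinal (leq_trans (isT : (0 < 3)%N) n3).
Let b : 'I_n := Ordinal (leq_trans (isT : (1 < 3)%N) n3).
(** [pcc] only asserts that some factor exists at each point; the sectional curvature of a fixed
    coordinate plane names it. *)
Let kappa i x : R := sectional (metric i) x (basis_vec R a) (basis_vec R b).

Lemma sectional_const G x k (X Y : 'rV[R]_n) : posdef (G x) -> row_free (col_mx X Y) ->
  (forall X1 X2 X3 X4, Riem G x X1 X2 X3 X4 =
    k * (met G x X1 X4 * met G x X2 X3 - met G x X1 X3 * met G x X2 X4)) ->
  sectional G x X Y = k.
Proof.
move=> pG fr E; have := gramdet_gt0 pG fr; rewrite /sectional E /gramdet -/(met G x _ _).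
rewrite -!/(met G x _ _) => d; have [sG _] := pG.
have -> : met G x X Y = met G x Y X by exact: gramC.
by rewrite -expr2 mulfK // gt_eqF // /met (gramC Y X sG).
Qed.

Let free_ab : row_free (col_mx (basis_vec R a) (basis_vec R b)).
Proof. exact: row_free_basis. Qed.

Let kappaP i x : chart_cod i x -> forall X1 X2 X3 X4, Riem (metric i) x X1 X2 X3 X4 =
  kappa i x * (met (metric i) x X1 X4 * met (metric i) x X2 X3
               - met (metric i) x X1 X3 * met (metric i) x X2 X4).
Proof.
move=> cx; have [k E] := pcc cx.
by rewrite /kappa (sectional_const (metric_posdef cx) free_ab E).
Qed.

Let kappa_change i j x : overlap i j x ->
  kappa i x = kappa j (chart_map j (chart_inv i x)).
Proof.
move=> ox; have [cx dx] := ox; have [cy _] := chart_mapK dx.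
pose e1 := basis_vec R a; pose e2 := basis_vec R b.
have := Riem_chart_change e1 e2 e2 e1 ox.
rewrite /= (kappaP cx) (kappaP cy) /met -!(metric_change _ _ ox).
have [sG _] := metric_posdef cx.
have := gramdet_gt0 (metric_posdef cx) free_ab.
rewrite /gramdet -/e1 -/e2 (gramC e2 e1 sG) => d; apply: mulIf.
by rewrite -expr2 gt_eqF.
Qed.

Let chart_at (p : M) : chart_index M := sval (cid (chart_cover p)).
Let chart_atP p : chart_dom (chart_at p) p.
Proof. exact: svalP (cid (chart_cover p)). Qed.
(** The chart at each point is a choice, made harmless by [kappa_change]. *)
Let curvature (p : M) : R := kappa (chart_at p) (chart_map (chart_at p) p).

Let curvatureE i x : chart_cod i x -> curvature (chart_inv i x) = kappa i x.
Proof.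
by move=> cx; apply/esym/kappa_change; split=> //; exact: chart_atP.
Qed.

Let curvature_near p : \forall q \near p, curvature q = curvature p.
Proof.
pose i := chart_at p; pose x := chart_map i p.
have [cx invx] := chart_mapK (chart_atP p).
have [r /= r0 Br] := (nbhs_ballP _ _).1 (open_nbhs_nbhs (conj (@open_cod _ _ M i) cx)).
have nd : nbhs p (chart_dom i) by exact: open_nbhs_nbhs (conj (@open_dom _ _ M i) (chart_atP p)).
have nb : nbhs p (chart_map i @^-1` ball x r).
  by apply: (chart_map_continuous (chart_atP p)); exact: nbhsx_ballx.
apply: filterS2 nd nb => q dq bq; have [cq invq] := chart_mapK dq.
rewrite -invq curvatureE // [RHS](_ : _ = kappa i x) //.
apply: derive0_ball bq => z bz; have cz := Br _ bz.
have H v := @schur_derive0 R n (metric i) (chart_cod i) (kappa i) n3 (@open_cod _ _ M i)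
  (metric_smooth i) (@metric_posdef i)
  (fun x X1 X2 X3 X4 cx => kappaP cx X1 X2 X3 X4) z v cz.
by split=> [|v]; [have [] := H 0|have [] := H v].
Qed.

Lemma schur_connected : constant_curvature M.
Proof.
case: (pselect (exists p0 : M, True)) => [[p0 _]|noM]; last first.
  by exists 0 => i x cx; case: noM; exists (chart_inv i x).
(* As [curvature] is locally constant, a level set and its complement are both open. *)
have loc (A : set R) : open [set q | A (curvature q)].
  rewrite openE => q Aq; apply: filterS (curvature_near q) => q' /= ->; exact: Aq.
have const : [set q | curvature q = curvature p0] = [set: M].
  apply: M_connected; first by exists p0.
  - exists [set q | curvature q = curvature p0]; last by rewrite setTI.
    exact: (loc [set c | c = curvature p0]).
  - exists [set q | curvature q = curvature p0]; last by rewrite setTI.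
    rewrite -openC; exact: (loc [set c | c <> curvature p0]).
exists (curvature p0) => i x cx X Y fr.
have <- : kappa i x = curvature p0.
  rewrite -(curvatureE cx).
  by have : [set: M] (chart_inv i x) by []; rewrite -const.
exact: sectional_const (metric_posdef cx) fr (kappaP cx).
Qed.

End RiemannianFields.

(** * Extremal eigenvectors of the Ricci operator *)

Section Trace.
Context {R : realType} {n : nat}.
Notation V := 'rV[R]_n.
Implicit Types (G A : 'M[R]_n).

Lemma eq_gtrace G (A B : V -> V -> R) : (forall X Y, A X Y = B X Y) -> gtrace G A = gtrace G B.
Proof. by move=> AB; apply: eq_bigr => a _; apply: eq_bigr => b _; rewrite AB. Qed.

Lemma gtraceB G (A B : V -> V -> R) :
  gtrace G (fun X Y => A X Y - B X Y) = gtrace G A - gtrace G B.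
Proof.
rewrite /gtrace -sumrB; apply: eq_bigr => a _; rewrite -sumrB; apply: eq_bigr => b _.
by rewrite mulrBr.
Qed.

Lemma gtraceZ G c (A : V -> V -> R) :
  gtrace G (fun X Y => c * A X Y) = c * gtrace G A.
Proof.
rewrite /gtrace mulr_sumr; apply: eq_bigr => a _; rewrite mulr_sumr; apply: eq_bigr => b _.
by rewrite mulrCA.
Qed.

Lemma gtrace_gram G A : gtrace G (gram A) = \tr (invmx G *m A^T).
Proof.
apply: eq_bigr => a _; rewrite mxE; apply: eq_bigr => b _.
by rewrite gram_basis -rowE !mxE.
Qed.

Lemma gtrace_metric G : posdef G -> gtrace G (gram G) = n%:R.
Proof.
move=> pG; rewrite gtrace_gram; case: (pG) => -> _.
by rewrite mulVmx ?posdef_unit // mxtrace1.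
Qed.

Lemma gtrace_rank1 G u v : posdef G ->
  gtrace G (fun X Y => gram G X u * gram G v Y) = gram G u v.
Proof.
move=> pG; have [sG _] := pG.
have E X Y : gram G X u * gram G v Y = gram (G *m u^T *m (v *m G)) X Y.
  have -> : gram (G *m u^T *m (v *m G)) X Y =
      ((X *m G *m u^T) *m (v *m G *m Y^T)) 0 0 by rewrite /gram !mulmxA.
  by rewrite mxE big_ord1.
rewrite (eq_gtrace _ E) gtrace_gram !trmx_mul trmxK sG.
rewrite !mulmxA mulVmx ?posdef_unit // mul1mx -mulmxA mxtrace_mulC.
by rewrite /mxtrace big_ord1 /gram.
Qed.

End Trace.

Section Extremal.
Context {R : realType} {n : nat}.
Notation V := 'rV[R]_n.
Implicit Types (G S H : 'M[R]_n).

Lemma semidefinite_kernel H c : H^T = H -> (forall X, 0 <= gram H X X) ->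
  gram H c c = 0 -> forall Z : V, gram H c Z = 0.
Proof.
move=> sH H0 cc Z; apply/eqP/negPn/negP => u0.
have w0 := H0 Z; set u := gram H c Z in u0 *; set w := gram H Z Z in w0 *.
(* The form is [2 t u + t ^+ 2 w] at [c + t *: Z]. The minimising [t = - u / w] would fail for
   [w = 0]; with [w + 1] the value is still negative unless [u = 0]. *)
have := H0 (c + (- u / (w + 1)) *: Z).
rewrite !(gramDl, gramDr, gramZl, gramZr) (gramC Z c sH) cc -/u -/w.
have w1 : w + 1 != 0 by rewrite gt_eqF // ltr_wpDl.
have -> : 0 + - u / (w + 1) * u + (- u / (w + 1) * u + - u / (w + 1) * (- u / (w + 1) * w)) =
   - (u ^+ 2 * (w + 2) / (w + 1) ^+ 2) by field.
rewrite oppr_ge0 leNgt => /negP; apply; apply: divr_gt0; last by apply: exprn_gt0; rewrite ltr_wpDl.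
by apply: mulr_gt0; [rewrite exprn_even_gt0|rewrite ltr_wpDl].
Qed.

Lemma gram_submx G H X Y : gram (G - H) X Y = gram G X Y - gram H X Y.
Proof. by rewrite /gram mulmxBr mulmxBl !mxE. Qed.

Lemma gram_scalemx a G X Y : gram (a *: G) X Y = a * gram G X Y.
Proof. by rewrite /gram -scalemxAr -scalemxAl mxE. Qed.

Lemma continuous_gram G : continuous (fun X : V => gram G X X).
Proof.
move=> X; apply/differentiable_continuous.
have dX : @mdiff R 'rV[R]_n 1 n (fun X => X) X by move=> i j; exact: differentiable_coord.
have : @mdiff R 'rV[R]_n 1 1 (fun X => X *m G *m X^T) X.
  apply: mdiff_mul (mdiff_tr dX); apply: mdiff_mul dX _; exact: mdiff_cst.
exact.
Qed.

(* A maximum of the Rayleigh quotient is an eigenvector. *)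
Lemma exists_max_eigen G S : posdef G -> S^T = S -> (0 < n)%N ->
  exists (a : V) (alpha : R), [/\ 0 < gram G a a, forall Z, gram S a Z = alpha * gram G a Z
    & forall X, gram S X X <= alpha * gram G X X].
Proof.
move=> pG sS n0; have [sG pp] := pG.
(* The quotient is homogeneous of degree 0, so the compact unit sphere of the ambient norm may
   replace that of [G]. *)
pose A : set V := [set X | `|X| = 1].
have A0 : A !=set0.
  pose v : V := const_mx 1; exists (`|v|^-1 *: v).
  rewrite /A /= normrZ normfV normr_id mulVf // normr_eq0.
  by apply/eqP => /rowP/(_ (Ordinal n0)) /eqP; rewrite !mxE oner_eq0.
have cA : compact A.
  apply: bounded_closed_compact.
    by exists 1; split=> // M M1 X; rewrite /A /= => ->; exact: ltW.
  rewrite (_ : A = (fun X : V => `|X|) @^-1` [set 1]) //.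
  by apply: closed_comp; [move=> X _; exact: norm_continuous|exact: closed_eq].
have nz (X : V) : A X -> X != 0.
  rewrite /A /= => X1; apply/eqP => X0; move: X1; rewrite X0 normr0 => /eqP.
  by rewrite eq_sym oner_eq0.
pose f (X : V) := gram S X X / gram G X X.
have cf : {within A, continuous f}.
  apply: continuous_in_subspaceT => X; rewrite inE => AX.
  have g0 : gram G X X != 0 by rewrite gt_eqF // pp // nz.
  exact: (cvgM (@continuous_gram S X) (cvgV g0 (@continuous_gram G X))).
have [a + maxa] := EVT_max_rV A0 cA cf.
rewrite inE => Aa; have a0 := pp _ (nz _ Aa).
have le X : gram S X X <= f a * gram G X X.
  have [->|X0] := eqVneq X 0; first by rewrite !gram0l mulr0.
  have nX : 0 < `|X| by rewrite normr_gt0.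
  have /maxa : `|X|^-1 *: X \in A.
    by rewrite inE /A /= normrZ normfV normr_id mulVf // gt_eqF.
  rewrite /f !(gramZl, gramZr) ler_pdivrMr; last by rewrite !mulr_gt0 ?invr_gt0 ?pp.
  have -> c : c * (`|X|^-1 * (`|X|^-1 * gram G X X)) = `|X|^-1 * (`|X|^-1 * (c * gram G X X)).
    by ring.
  by rewrite !ler_pM2l ?invr_gt0.
exists a, (f a); split=> // Z.
apply/esym/eqP; rewrite -subr_eq0 -gram_scalemx -gram_submx; apply/eqP.
(* At the maximum [f a], the form [f a *: G - S] is positive semidefinite and vanishes on [a]. *)
apply: semidefinite_kernel.
- by apply/matrixP => i j; rewrite !mxE -[in LHS]sG -[in LHS]sS !mxE.
- by move=> X; rewrite gram_submx gram_scalemx subr_ge0.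
- by rewrite gram_submx gram_scalemx /f divfK ?subrr // gt_eqF.
Qed.

(** Maximising for [S] and for [- S] gives the extremal eigenvalues [alpha] and [- beta]. If they
    agree, [alpha *: G - S] is squeezed to zero; otherwise the symmetry of [S] makes the
    eigenvectors orthogonal. *)
Lemma scalar_or_eigenpair G S : posdef G -> S^T = S -> (0 < n)%N ->
  (exists c, S = c *: G) \/
  exists (a b : V) (alpha beta : R), [/\ alpha != beta,
    [/\ gram G a a = 1, gram G b b = 1 & gram G a b = 0],
    forall Z, gram S a Z = alpha * gram G a Z & forall Z, gram S b Z = beta * gram G b Z].
Proof.
move=> pG sS n0; have [sG pp] := pG.
have sNS : (- S)^T = - S by rewrite linearN /= sS.
have [a [alpha [a0 Ha maxa]]] := exists_max_eigen pG sS n0.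
have [b [beta [b0 Hb maxb]]] := exists_max_eigen pG sNS n0.
have Hb' Z : gram S b Z = - beta * gram G b Z.
  by apply: oppr_inj; rewrite -gram_oppmx Hb mulNr opprK.
have [ab|ab] := eqVneq alpha (- beta).
  left; exists alpha; apply: eq_gram => X Z.
  apply/esym/eqP; rewrite -subr_eq0 -gram_submx; apply/eqP.
  apply: semidefinite_kernel.
  - by apply/matrixP => i j; rewrite !mxE -[in LHS]sG -[in LHS]sS !mxE.
  - by move=> Y; rewrite gram_submx gram_scalemx subr_ge0.
  - rewrite gram_submx gram_scalemx; have := maxa X; have := maxb X.
    by rewrite gram_oppmx ab; lra.
right; have gab : gram G a b = 0.
  have := Ha b; rewrite (gramC a b sS) Hb' (gramC b a sG) => /eqP.
  rewrite eq_sym -subr_eq0 -mulrBl mulf_eq0 subr_eq0 (negPf ab) /= => /eqP.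
  by rewrite gramC.
have unit X : 0 < gram G X X -> exists c, gram G (c *: X) (c *: X) = 1.
  move=> X0; exists (Num.sqrt (gram G X X))^-1; rewrite gramZl gramZr mulrA -invfM -expr2.
  by rewrite sqr_sqrtr ?ltW // mulVf // gt_eqF.
have [c Hc] := unit a a0; have [d Hd] := unit b b0.
exists (c *: a), (d *: b), alpha, (- beta); split=> //.
- by split=> //; rewrite gramZl gramZr gab !mulr0.
- by move=> Z; rewrite !gramZl Ha mulrCA.
- by move=> Z; rewrite !gramZl Hb' mulrCA.
Qed.

End Extremal.

(** * Algebra of a pair of eigenvectors *)

(** As [T] kills [Z] and [Z'], only the terms T (H u Z Z') and H (T u) Z Z' survive, both multiples
    of [v]. *)
Lemma act13_eigen (R : realType) (n : nat) (H : 'rV[R]_n -> 'rV[R]_n -> 'rV[R]_n -> 'rV[R]_n)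
    (T : 'rV[R]_n -> 'rV[R]_n) u v c hu hv Z Z' :
  (forall c X Y Z, H (c *: X) Y Z = c *: H X Y Z) ->
  (forall X Z, H X 0 Z = 0) -> (forall X Y, H X Y 0 = 0) ->
  (forall c X, T (c *: X) = c *: T X) -> T u = c *: v -> T Z = 0 -> T Z' = 0 ->
  H u Z Z' = hu *: u -> H v Z Z' = hv *: v ->
  act13 T H u Z Z' = (c * (hu - hv)) *: v.
Proof.
move=> H1 H2 H3 TZ Tu Tz Tz' Hu Hv.
rewrite /act13 Hu TZ Tu Tz Tz' H1 H2 H3 Hv !addr0 !scalerA -scalerBl.
by congr (_ *: _); ring.
Qed.

Section RoterPoint.
Context {R : realType} {n : nat}.
Notation V := 'rV[R]_n.
Variables (G S : 'M[R]_n).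
Hypotheses (pG : posdef G) (sS : S^T = S).

Let sG : G^T = G. Proof. by case: pG. Qed.
Let uG : G \in unitmx. Proof. exact: posdef_unit. Qed.

(** The Gram matrix of the form S^2, since the Ricci operator acts on rows as [S *m invmx G]. *)
Definition sqmx := S *m invmx G *m S.
Let S2 := sqmx.

Definition roter (c1 c2 c3 c4 c5 c6 : R) (X1 X2 X3 X4 : V) :=
  let g := gram G in let s := gram S in let s2 := gram sqmx in
  c1 * kulkarni_nomizu g g X1 X2 X3 X4 + c2 * kulkarni_nomizu g s X1 X2 X3 X4
  + c3 * kulkarni_nomizu s s X1 X2 X3 X4 + c4 * kulkarni_nomizu g s2 X1 X2 X3 X4
  + c5 * kulkarni_nomizu s s2 X1 X2 X3 X4 + c6 * kulkarni_nomizu s2 s2 X1 X2 X3 X4.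

Variables (c1 c2 c3 c4 c5 c6 m : R).
Let Rm := roter c1 c2 c3 c4 c5 c6.

Definition projective (X1 X2 X3 X4 : V) :=
  Rm X1 X2 X3 X4 - m * (gram S X2 X3 * gram G X1 X4 - gram S X1 X3 * gram G X2 X4).

Variables (R13 P13 : V -> V -> V -> V).
Hypothesis hR : forall X Y Z W, gram G (R13 X Y Z) W = Rm X Y Z W.
Hypothesis hP : forall X Y Z W, gram G (P13 X Y Z) W = projective X Y Z W.
Hypothesis hRic : forall Y Z, gram S Y Z = gtrace G (fun X W => Rm X Y Z W).

(* [R(u, Z, Z', W) = slice l (Z, Z') g(u, W)] for an [l]-eigenvector [u] orthogonal to [Z], [Z']. *)
Definition slice (l : R) : 'M[R]_n :=
  (2 * c1 + c2 * l + c4 * l ^+ 2) *: G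
  + (c2 + 2 * c3 * l + c5 * l ^+ 2) *: S
  + (c4 + c5 * l + 2 * c6 * l ^+ 2) *: S2.

(** The value of [slice l] on a unit [t]-eigenvector. For orthonormal eigenvectors of eigenvalues
    [l] and [t] it is the sectional curvature of their plane, hence symmetric in [l] and [t]. *)
Definition sliceval (l t : R) : R :=
  (2 * c1 + c2 * l + c4 * l ^+ 2) + (c2 + 2 * c3 * l + c5 * l ^+ 2) * t
  + (c4 + c5 * l + 2 * c6 * l ^+ 2) * t ^+ 2.

Definition eigen (l : R) (u : V) := forall Z, gram S u Z = l * gram G u Z.

Lemma sliceE l X Y : gram (slice l) X Y =
  (2 * c1 + c2 * l + c4 * l ^+ 2) * gram G X Y
  + (c2 + 2 * c3 * l + c5 * l ^+ 2) * gram S X Y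
  + (c4 + c5 * l + 2 * c6 * l ^+ 2) * gram S2 X Y.
Proof.
have D A B : gram (A + B) X Y = gram A X Y + gram B X Y by rewrite /gram mulmxDr mulmxDl mxE.
by rewrite /slice !D !gram_scalemx.
Qed.

Lemma eigen_sq l u : eigen l u -> forall Z, gram S2 u Z = l ^+ 2 * gram G u Z.
Proof.
move=> Hu Z; have E : u *m S = l *: (u *m G).
  by apply/rowP => i; rewrite [RHS]mxE -!gram_basis Hu.
rewrite /gram /S2 /sqmx !mulmxA E -!scalemxAl mulmxK // E -!scalemxAl !mxE /=.
by rewrite mulrA -expr2.
Qed.

Lemma sqmx_sym : S2^T = S2.
Proof. by rewrite /S2 /sqmx !trmx_mul trmx_inv sG sS mulmxA. Qed.

Lemma eigenr l u : eigen l u -> forall Z, gram S Z u = l * gram G Z u.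
Proof. by move=> Hu Z; rewrite gramC // Hu gramC. Qed.

Lemma eigen_sqr l u : eigen l u -> forall Z, gram S2 Z u = l ^+ 2 * gram G Z u.
Proof. by move=> Hu Z; rewrite (gramC _ _ sqmx_sym) (eigen_sq Hu) gramC. Qed.

Lemma slice_eigen l t u X : eigen t u -> gram (slice l) u X = sliceval l t * gram G u X.
Proof. by move=> Hu; rewrite sliceE Hu (eigen_sq Hu) /sliceval; ring. Qed.

Lemma slice_eigenr l t u X : eigen t u -> gram (slice l) X u = sliceval l t * gram G X u.
Proof. by move=> Hu; rewrite sliceE (eigenr Hu) (eigen_sqr Hu) /sliceval; ring. Qed.

Lemma slicevalC l t : sliceval l t = sliceval t l.
Proof. by rewrite /sliceval; ring. Qed.

(** All three forms send [u] to multiples of g(u, .), so the products pairing [u] with [Z'] vanish.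
    The coefficients 2 in [slice] come from the squares, whose two remaining terms coincide. *)
Lemma roter_eigen l u Z Z' W : eigen l u -> gram G u Z = 0 -> gram G u Z' = 0 ->
  Rm u Z Z' W = gram (slice l) Z Z' * gram G u W.
Proof.
move=> Hu uZ uZ'; rewrite /Rm /roter /kulkarni_nomizu sliceE.
by rewrite !Hu !(eigen_sq Hu) uZ'; ring.
Qed.

Lemma roter_trace l u X W : eigen l u -> gram G u u = 1 ->
  Rm X u u W = gram (slice l) X W - sliceval l l * (gram G X u * gram G u W).
Proof.
move=> Hu uu; rewrite /Rm /roter /kulkarni_nomizu sliceE /sliceval.
by rewrite !Hu !(eigen_sq Hu) !(eigenr Hu) !(eigen_sqr Hu) uu -/S2; ring.
Qed.

Lemma R13_eigen l u Z Z' : eigen l u -> gram G u Z = 0 -> gram G u Z' = 0 ->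
  R13 u Z Z' = gram (slice l) Z Z' *: u.
Proof. by move=> Hu uZ uZ'; apply: (gram_inj uG) => W; rewrite hR (roter_eigen _ Hu) // gramZl. Qed.

Lemma P13_eigen l u Z Z' : eigen l u -> gram G u Z = 0 -> gram G u Z' = 0 ->
  P13 u Z Z' = (gram (slice l) Z Z' - m * gram S Z Z') *: u.
Proof.
move=> Hu uZ uZ'; apply: (gram_inj uG) => W.
by rewrite hP /projective (roter_eigen _ Hu) // gramZl Hu uZ'; ring.
Qed.

Let gramZ := (@gramZl R n, @gramZr R n).

Lemma roterZ1 c X Y Z W : Rm (c *: X) Y Z W = c * Rm X Y Z W.
Proof. by rewrite /Rm /roter /kulkarni_nomizu !gramZ; ring. Qed.
Lemma roterZ2 c X Y Z W : Rm X (c *: Y) Z W = c * Rm X Y Z W.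
Proof. by rewrite /Rm /roter /kulkarni_nomizu !gramZ; ring. Qed.
Lemma roterZ3 c X Y Z W : Rm X Y (c *: Z) W = c * Rm X Y Z W.
Proof. by rewrite /Rm /roter /kulkarni_nomizu !gramZ; ring. Qed.
Lemma roterZ4 c X Y Z W : Rm X Y Z (c *: W) = c * Rm X Y Z W.
Proof. by rewrite /Rm /roter /kulkarni_nomizu !gramZ; ring. Qed.

Lemma projectiveZ1 c X Y Z W : projective (c *: X) Y Z W = c * projective X Y Z W.
Proof. by rewrite /projective roterZ1 !gramZ; ring. Qed.
Lemma projectiveZ2 c X Y Z W : projective X (c *: Y) Z W = c * projective X Y Z W.
Proof. by rewrite /projective roterZ2 !gramZ; ring. Qed.
Lemma projectiveZ3 c X Y Z W : projective X Y (c *: Z) W = c * projective X Y Z W.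
Proof. by rewrite /projective roterZ3 !gramZ; ring. Qed.
Lemma projectiveZ4 c X Y Z W : projective X Y Z (c *: W) = c * projective X Y Z W.
Proof. by rewrite /projective roterZ4 !gramZ; ring. Qed.

Lemma projective_anti X Y Z W : projective X Y Z W = - projective Y X Z W.
Proof. by rewrite /projective /Rm /roter /kulkarni_nomizu; ring. Qed.

Lemma P13_anti X Y Z : P13 X Y Z = - P13 Y X Z.
Proof. by apply: (gram_inj uG) => W; rewrite gramNl !hP projective_anti. Qed.

Lemma P13Z3 X Y c Z : P13 X Y (c *: Z) = c *: P13 X Y Z.
Proof. by apply: (gram_inj uG) => W; rewrite gramZl !hP projectiveZ3. Qed.

Lemma wedgeZ (B : 'M[R]_n) X Y c Z :
  wedge_endo (gram B) X Y (c *: Z) = c *: wedge_endo (gram B) X Y Z.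
Proof. by rewrite /wedge_endo !gramZr scalerBr !scalerA. Qed.

Section EigenPair.
Variables (a b : V) (al be : R).
Hypotheses (alNbe : al != be) (aa : gram G a a = 1) (bb : gram G b b = 1)
  (ab : gram G a b = 0) (Ha : eigen al a) (Hb : eigen be b).

Let ba : gram G b a = 0. Proof. by rewrite gramC. Qed.

Definition perp Z := gram G a Z = 0 /\ gram G b Z = 0.

Let kappa := sliceval al be.

Lemma P13_abb : P13 a b b = (kappa - m * be) *: a.
Proof. by rewrite (P13_eigen Ha) // (slice_eigen _ _ Hb) Hb bb !mulr1. Qed.

Lemma P13_aba : P13 a b a = - (kappa - m * al) *: b.
Proof.
rewrite P13_anti (P13_eigen Hb) // (slice_eigen _ _ Ha) Ha aa !mulr1.
by rewrite slicevalC scaleNr.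
Qed.

Lemma P13_perp Z : perp Z -> P13 a b Z = 0.
Proof.
by case=> aZ bZ; rewrite (P13_eigen Ha) // (slice_eigen _ _ Hb) Hb bZ !mulr0 subrr scale0r.
Qed.

(* [B] plays the role of [g] or [S] in Q(g, H) and Q(S, H). *)
Variables (B : 'M[R]_n) (Ba Bb L : R).
Hypotheses (HBa : forall Z, gram B a Z = Ba * gram G a Z)
  (HBb : forall Z, gram B b Z = Bb * gram G b Z).
(** This says [p != q], where [T = P(a, b) - L W] satisfies [T b = p a] and [T a = - q b]. *)
Hypothesis Lne : m * (al - be) != L * (Bb - Ba).

Let W := wedge_endo (gram B) a b.

Lemma wedge_abb : W b = Bb *: a.
Proof. by rewrite /W /wedge_endo HBa HBb ab bb mulr1 mulr0 scale0r subr0. Qed.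

Lemma wedge_aba : W a = - Ba *: b.
Proof. by rewrite /W /wedge_endo HBa HBb ba aa mulr1 mulr0 scale0r sub0r scaleNr. Qed.

Lemma wedge_perp Z : perp Z -> W Z = 0.
Proof. by case=> aZ bZ; rewrite /W /wedge_endo HBa HBb aZ bZ !mulr0 !scale0r subr0. Qed.

(** The hypotheses read [q k = 0] and [p k = 0]; their combination is [(p - q) k = 0]. *)
Lemma cancel_pair k : - (kappa - m * al) * k = L * (- Ba * k) ->
  (kappa - m * be) * k = L * (Bb * k) -> k = 0.
Proof.
move=> E1 E2; have : (m * (al - be) - L * (Bb - Ba)) * k = 0 by lra.
by move/eqP; rewrite mulf_eq0 subr_eq0 (negPf Lne) => /eqP.
Qed.

Lemma scaler_unit_inj s t u : gram G u u = 1 -> s *: u = t *: u :> V -> s = t.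
Proof. by move=> uu /(congr1 (gram G^~ u)); rewrite !gramZl uu !mulr1. Qed.

(** That [T] commutes with [op] reads [q (al - be) = 0] at [a] and [p (al - be) = 0] at [b]. *)
Lemma act11_eigenpair (op : V -> V) : (forall X Y, gram G (op X) Y = gram S X Y) ->
  (forall X, act11 (P13 a b) op X = L *: act11 W op X) -> False.
Proof.
move=> hop E.
have opZ c X : op (c *: X) = c *: op X.
  by apply: (gram_inj uG) => Z; rewrite gramZl !hop gramZl.
have opE l u : eigen l u -> op u = l *: u.
  by move=> Hu; apply: (gram_inj uG) => Z; rewrite hop Hu gramZl.
have WZ c X : W (c *: X) = c *: W X by exact: wedgeZ.
have := E b; have := E a.
rewrite /act11 (opE _ _ Ha) (opE _ _ Hb) !P13Z3 !WZ.
rewrite P13_abb P13_aba wedge_abb wedge_aba !opZ (opE _ _ Ha) (opE _ _ Hb).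
rewrite !scalerA -!scalerBl !scalerA => /(scaler_unit_inj bb) E1 /(scaler_unit_inj aa) E2.
have : al - be = 0 by apply: cancel_pair; lra.
by move/eqP; rewrite subr_eq0 (negPf alNbe).
Qed.

(** P is skew in its first two arguments but not in its last two: P(a, b, b, a) + P(a, b, a, b) = m
    (al - be). Evaluation on (a, b, b, b) and (b, a, a, a) isolates this defect, multiplied by [p]
    and by [q] up to sign. *)
Lemma act04_eigenpair :
  (forall X1 X2 X3 X4, act04 (P13 a b) projective X1 X2 X3 X4 =
     L * act04 W projective X1 X2 X3 X4) -> m = 0.
Proof.
move=> E.
have ev1 T c d : T a = c *: b -> T b = d *: a ->
    act04 T projective a b b b = - (d * (m * (al - be))).
  move=> Ta Tb; rewrite /act04 Ta Tb projectiveZ1 projectiveZ2 projectiveZ3 projectiveZ4.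
  rewrite -!hP P13_abb P13_aba !gramZl aa bb.
  have z u : projective u u b b = 0.
    by have := projective_anti u u b b; lra.
  by rewrite !hP !z; ring.
have ev2 T c d : T a = c *: b -> T b = d *: a ->
    act04 T projective b a a a = c * (m * (al - be)).
  move=> Ta Tb; rewrite /act04 Ta Tb projectiveZ1 projectiveZ2 projectiveZ3 projectiveZ4.
  rewrite (projective_anti b a b) (projective_anti b a a) -!hP P13_abb P13_aba !gramZl aa bb.
  have z u : projective u u a a = 0.
    by have := projective_anti u u a a; lra.
  by rewrite !hP !z; ring.
have := E b a a a; have := E a b b b.
rewrite (ev1 _ _ _ P13_aba P13_abb) (ev1 _ _ _ wedge_aba wedge_abb).
rewrite (ev2 _ _ _ P13_aba P13_abb) (ev2 _ _ _ wedge_aba wedge_abb) => E1 E2.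
have : m * (al - be) = 0 by apply: cancel_pair; lra.
by move/eqP; rewrite mulf_eq0 subr_eq0 (negPf alNbe) orbF => /eqP.
Qed.

(** The difference of the two slices vanishes on the complement of [a] and [b] and is diagonal on
    their span. Hence R(X, a, a, Y) - R(X, b, b, Y) is [kappa] times g(X, b) g(b, Y) - g(X, a) g(a,
    Y), which has trace 0, whereas the trace of the left side is [al - be]. *)
Lemma slices_eq_absurd :
  (forall Z Z', perp Z -> perp Z' -> gram (slice al) Z Z' = gram (slice be) Z Z') -> False.
Proof.
move=> E.
pose pr X := X - gram G a X *: a - gram G b X *: b.
have perp_pr X : perp (pr X).
  by split; rewrite /pr !(gramDr, gramNr, gramZr) ?aa ?bb ?ab ?ba; ring.
have dec X : X = gram G a X *: a + gram G b X *: b + pr X.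
  by rewrite /pr addrC -[_ - _ - _]addrA -opprD subrK.
have main X Y : gram (slice al) X Y - gram (slice be) X Y =
   (sliceval al al - kappa) * (gram G X a * gram G a Y)
   + (kappa - sliceval be be) * (gram G X b * gram G b Y).
  rewrite (gramC X a sG) (gramC X b sG) -gram_submx.
  set D := slice al - slice be.
  have Da Z : gram D a Z = (sliceval al al - kappa) * gram G a Z.
    by rewrite gram_submx !(slice_eigen _ _ Ha) (slicevalC be); rewrite /kappa; ring.
  have Da' Z : gram D Z a = (sliceval al al - kappa) * gram G Z a.
    by rewrite gram_submx !(slice_eigenr _ _ Ha) (slicevalC be); rewrite /kappa; ring.
  have Db Z : gram D b Z = (kappa - sliceval be be) * gram G b Z.
    by rewrite gram_submx !(slice_eigen _ _ Hb); rewrite /kappa; ring.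
  have Db' Z : gram D Z b = (kappa - sliceval be be) * gram G Z b.
    by rewrite gram_submx !(slice_eigenr _ _ Hb); rewrite /kappa; ring.
  have D0 : gram D (pr X) (pr Y) = 0.
    by rewrite gram_submx E ?subrr //; exact: perp_pr.
  have [pa pb] := perp_pr X; have [qa qb] := perp_pr Y.
  have pa' : gram G (pr X) a = 0 by rewrite gramC.
  have pb' : gram G (pr X) b = 0 by rewrite gramC.
  rewrite [in LHS](dec X) [in LHS](dec Y).
  move: (pr X) (pr Y) (gram G a X) (gram G b X) (gram G a Y) (gram G b Y)
    D0 qa qb pa' pb' {pa pb} => X' Y' xa xb ya yb D0 qa qb pa pb.
  rewrite !(gramDl, gramDr, gramZl, gramZr) D0 !(Da, Da', Db, Db') aa bb ab ba qa qb pa pb.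
  by ring.
have : gram S a a - gram S b b = 0.
  rewrite !hRic -gtraceB.
  rewrite (@eq_gtrace _ _ _ _ (fun X Y =>
      kappa * (gram G X b * gram G b Y) - kappa * (gram G X a * gram G a Y))).
    by rewrite gtraceB !gtraceZ !gtrace_rank1 // aa bb subrr.
  move=> X Y; rewrite (roter_trace _ _ Ha aa) (roter_trace _ _ Hb bb).
  by have := main X Y; lra.
rewrite Ha Hb aa bb !mulr1 => /eqP; rewrite subr_eq0.
by rewrite (negPf alNbe).
Qed.

(** Covers R with [mu = 0] and P with [mu = m]: the term in [mu] is the same for [a] and [b], so it
    drops out of the difference that [cancel_pair] kills. *)
Lemma act13_eigenpair (H : V -> V -> V -> V) mu :
  (forall c X Y Z, H (c *: X) Y Z = c *: H X Y Z) ->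
  (forall X Z, H X 0 Z = 0) -> (forall X Y, H X Y 0 = 0) ->
  (forall l u Z Z', eigen l u -> gram G u Z = 0 -> gram G u Z' = 0 ->
     H u Z Z' = (gram (slice l) Z Z' - mu * gram S Z Z') *: u) ->
  (forall X1 X2 X3, act13 (P13 a b) H X1 X2 X3 = L *: act13 W H X1 X2 X3) -> False.
Proof.
move=> H1 H2 H3 HE E; apply: slices_eq_absurd => Z Z' pZ pZ'.
have [aZ bZ] := pZ; have [aZ' bZ'] := pZ'.
have Ea := HE _ _ _ _ Ha aZ aZ'; have Eb := HE _ _ _ _ Hb bZ bZ'.
have PZ c X : P13 a b (c *: X) = c *: P13 a b X by exact: P13Z3.
have WZ c X : W (c *: X) = c *: W X by exact: wedgeZ.
have := E b Z Z'; have := E a Z Z'.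
rewrite (act13_eigen H1 H2 H3 PZ P13_aba (P13_perp pZ) (P13_perp pZ') Ea Eb).
rewrite (act13_eigen H1 H2 H3 WZ wedge_aba (wedge_perp pZ) (wedge_perp pZ') Ea Eb).
rewrite (act13_eigen H1 H2 H3 PZ P13_abb (P13_perp pZ) (P13_perp pZ') Eb Ea).
rewrite (act13_eigen H1 H2 H3 WZ wedge_abb (wedge_perp pZ) (wedge_perp pZ') Eb Ea).
rewrite !scalerA => /(scaler_unit_inj bb) E1 /(scaler_unit_inj aa) E2.
have : gram (slice al) Z Z' - gram (slice be) Z Z' = 0.
  by apply: cancel_pair; lra.
by move/eqP; rewrite subr_eq0 => /eqP.
Qed.

End EigenPair.

End RoterPoint.

(** * Symmetries of the curvature tensor *)

Section CurvatureTensor.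
Context {R : realType} {n : nat}.
Notation V := 'rV[R]_n.

Lemma bilinear_gramE (f : V -> V -> R) X Y :
  (forall a X X' Y, f (a *: X + X') Y = a * f X Y + f X' Y) ->
  (forall a X Y Y', f X (a *: Y + Y') = a * f X Y + f X Y') ->
  f X Y = gram (\matrix_(a, b) f (basis_vec R a) (basis_vec R b)) X Y.
Proof.
move=> fl fr; rewrite (linear_functionalE (w := f^~ Y)) //.
rewrite /gram -mulmxA mxE; apply: eq_bigr => a _; congr (_ * _).
rewrite (linear_functionalE (w := f _)) // mxE; apply: eq_bigr => b _.
by rewrite !mxE mulrC.
Qed.

(** Among the four Bianchi identities for the rotated arguments, the sum of those for (X, Y, Z, W)
    and (Y, Z, W, X) minus the sum of the other two is twice the difference of the sides. *)
Lemma curvature_pair_sym (T : Type) (F : T -> T -> T -> T -> R) :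
  (forall X Y Z W, F X Y Z W = - F Y X Z W) ->
  (forall X Y Z W, F X Y Z W = - F X Y W Z) ->
  (forall X Y Z W, F X Y Z W + F Y Z X W + F Z X Y W = 0) ->
  forall X Y Z W, F X Y Z W = F Z W X Y.
Proof.
move=> a12 a34 b X Y Z W.
have := b X Y Z W; have := b Y Z W X; have := b Z W X Y; have := b W X Y Z.
rewrite (a34 Z W Y X) (a34 X Y W Z) (a34 Y Z W X) (a12 X Z W Y) (a34 Z X W Y).
rewrite (a34 W X Z Y) (a12 W Y Z X) (a34 Y W Z X).
lra.
Qed.

Lemma curvature_rev (T : Type) (F : T -> T -> T -> T -> R) :
  (forall X Y Z W, F X Y Z W = - F Y X Z W) ->
  (forall X Y Z W, F X Y Z W = - F X Y W Z) ->
  (forall X Y Z W, F X Y Z W + F Y Z X W + F Z X Y W = 0) ->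
  forall X Y Z W, F X Y Z W = F W Z Y X.
Proof.
by move=> a12 a34 b X Y Z W; rewrite (curvature_pair_sym a12 a34 b) a12 a34 opprK.
Qed.

Lemma curvature_lin2 (F : V -> V -> V -> V -> R) :
  (forall a X X' Y Z W, F (a *: X + X') Y Z W = a * F X Y Z W + F X' Y Z W) ->
  (forall X Y Z W, F X Y Z W = - F Y X Z W) ->
  forall a X Y Y' Z W, F X (a *: Y + Y') Z W = a * F X Y Z W + F X Y' Z W.
Proof. by move=> l a12 a X Y Y' Z W; rewrite !(a12 X) l; ring. Qed.

(** Polarising F X Y Y X = 0 makes [F] skew in its second and third arguments. Being skew in the
    first two as well, it is invariant under cyclic permutation of the first three, and the Bianchi
    identity reads 3 F = 0. *)
Lemma curvature_vanish (F : V -> V -> V -> V -> R) :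
  (forall X X' Y Z W, F (X + X') Y Z W = F X Y Z W + F X' Y Z W) ->
  (forall X Y Z W, F X Y Z W = - F Y X Z W) ->
  (forall X Y Z W, F X Y Z W = - F X Y W Z) ->
  (forall X Y Z W, F X Y Z W + F Y Z X W + F Z X Y W = 0) ->
  (forall X Y, F X Y Y X = 0) -> forall X Y Z W, F X Y Z W = 0.
Proof.
move=> D1 a12 a34 b diag.
have ps := curvature_pair_sym a12 a34 b.
have D2 X Y Y' Z W : F X (Y + Y') Z W = F X Y Z W + F X Y' Z W.
  by rewrite !(a12 X) D1 opprD.
have D3 X Y Z Z' W : F X Y (Z + Z') W = F X Y Z W + F X Y Z' W.
  by rewrite !(ps X Y) D1.
have D4 X Y Z W W' : F X Y Z (W + W') = F X Y Z W + F X Y Z W'.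
  by rewrite !(a34 X Y Z) D3 opprD.
have H1 X Y W : F X Y Y W = 0.
  have := diag (X + W) Y; rewrite D1 !D4 !diag.
  have : F W Y Y X = F X Y Y W by rewrite ps a12 a34 opprK.
  lra.
have H2 X Y Z W : F X Y Z W = - F X Z Y W.
  by have := H1 X (Y + Z) W; rewrite D2 !D3 !H1; lra.
move=> X Y Z W; have := b X Y Z W; have := a12 X Y Z W; have := H2 Y Z X W.
by have := a12 Z X Y W; have := H2 X Y Z W; lra.
Qed.

End CurvatureTensor.

(** * Curvature, Ricci and projective tensors at a point of a chart *)

Section ChartPoint.
Context {R : realType} {n : nat}.
Notation V := 'rV[R]_n.
Variables (G : V -> 'M[R]_n) (U : set V) (x : V).
Hypotheses (oU : open U) (smG : msmooth U G).
Hypotheses (pdG : forall y, U y -> posdef (G y)) (Ux : U x).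

Let pG : posdef (G x). Proof. exact: pdG. Qed.
Let sG : (G x)^T = G x. Proof. by case: pG. Qed.
Let uG : G x \in unitmx. Proof. exact: posdef_unit. Qed.
Let RmE X Y Z W : Riem G x X Y Z W = gram (curv G X Y x *m G x) Z W.
Proof. exact: (RiemE oU smG pdG). Qed.

Lemma Riem_lin1 a X X' Y Z W :
  Riem G x (a *: X + X') Y Z W = a * Riem G x X Y Z W + Riem G x X' Y Z W.
Proof.
rewrite !RmE (curvDl oU smG pdG _ _ _ Ux) (curvZl oU smG pdG _ _ _ Ux).
rewrite mulmxDl -scalemxAl.
have -> A B : gram (a *: A + B) Z W = a * gram A Z W + gram B Z W.
  by rewrite /gram mulmxDr mulmxDl -scalemxAr -scalemxAl !mxE.
by [].
Qed.

Lemma Riem_anti12 X Y Z W : Riem G x X Y Z W = - Riem G x Y X Z W.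
Proof. by rewrite !RmE curv_anti mulNmx gram_oppmx. Qed.

Lemma Riem_anti34 X Y Z W : Riem G x X Y Z W = - Riem G x X Y W Z.
Proof.
rewrite !RmE gram_tr trmx_mul sG -gram_oppmx.
have /eqP := curv_skew oU smG pdG X Y Ux.
by rewrite addrC addr_eq0 => /eqP ->.
Qed.

Lemma Riem_bianchi X Y Z W : Riem G x X Y Z W + Riem G x Y Z X W + Riem G x Z X Y W = 0.
Proof.
rewrite !RmE /gram !mulmxA.
have D (A B C : V) : (A *m G x *m W^T) 0 0 + (B *m G x *m W^T) 0 0 + (C *m G x *m W^T) 0 0
    = ((A + B + C) *m G x *m W^T) 0 0 by rewrite !mulmxDl !mxE.
by rewrite D (curv_bianchi1 oU smG pdG _ _ _ Ux) !mul0mx mxE.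
Qed.

Lemma Riem_rev X Y Z W : Riem G x X Y Z W = Riem G x W Z Y X.
Proof. exact: (curvature_rev Riem_anti12 Riem_anti34 Riem_bianchi). Qed.

Lemma Riem_lin2 a X Y Y' Z W :
  Riem G x X (a *: Y + Y') Z W = a * Riem G x X Y Z W + Riem G x X Y' Z W.
Proof. exact: (curvature_lin2 Riem_lin1 Riem_anti12). Qed.

Lemma Ric_lin1 a X X' Y : Ric G x (a *: X + X') Y = a * Ric G x X Y + Ric G x X' Y.
Proof.
rewrite /Ric /gtrace mulr_sumr -big_split; apply: eq_bigr => i _ /=.
rewrite mulr_sumr -big_split; apply: eq_bigr => j _ /=.
by rewrite (Riem_lin2 a (basis_vec R i) X X' Y (basis_vec R j)) mulrDr mulrCA.
Qed.

(** Reversing the four arguments of R exchanges the two traced slots, which the symmetry of the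
    inverse metric absorbs. *)
Lemma Ric_sym X Y : Ric G x X Y = Ric G x Y X.
Proof.
rewrite /Ric /gtrace.
rewrite [LHS]exchange_big.
apply: eq_bigr => i _.
apply: eq_bigr => j _.
rewrite (Riem_rev (basis_vec R j) X Y (basis_vec R i)); congr (_ * _).
by rewrite -[in LHS]sG -trmx_inv mxE.
Qed.

Lemma Ric_lin2 a X Y Y' : Ric G x X (a *: Y + Y') = a * Ric G x X Y + Ric G x X Y'.
Proof. by rewrite (Ric_sym X (_ + _)) Ric_lin1 (Ric_sym Y) (Ric_sym Y'). Qed.

Definition ricmx : 'M[R]_n :=
  \matrix_(a, b) Ric G x (basis_vec R a) (basis_vec R b).

Lemma RicE X Y : Ric G x X Y = gram ricmx X Y.
Proof. by apply: bilinear_gramE => *; [exact: Ric_lin1|exact: Ric_lin2]. Qed.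

Lemma ricmx_sym : ricmx^T = ricmx.
Proof. by apply/matrixP => a b; rewrite !mxE Ric_sym. Qed.

Lemma RicOpE X : RicOp G x X = X *m ricmx *m invmx (G x).
Proof.
apply: (gram_inj uG) => W; rewrite gram_sharp //; last by move=> *; exact: Ric_lin2.
by rewrite RicE /gram mulmxKV.
Qed.

Lemma gram_RicOp X Y : gram (G x) (RicOp G x X) Y = gram ricmx X Y.
Proof. by rewrite RicOpE /gram mulmxKV. Qed.

Lemma Ric2E X Y : Ric2 G x X Y = gram (sqmx (G x) ricmx) X Y.
Proof.
by rewrite /Ric2 /met gram_RicOp RicOpE /gram /sqmx !mulmxA.
Qed.

Let m : R := (n%:R - 1)^-1.

Lemma ProjE X Y Z W : Proj G x X Y Z W = Riem G x X Y Z W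
  - m * (gram ricmx Y Z * gram (G x) X W - gram ricmx X Z * gram (G x) Y W).
Proof. by rewrite /Proj !RicE. Qed.

Lemma gram_Proj13 X Y Z W : gram (G x) (Proj13 G x X Y Z) W = Proj G x X Y Z W.
Proof.
rewrite gram_sharp // => a A B.
rewrite !ProjE /Riem /met !(gramDr, gramZr); ring.
Qed.

Lemma Riem13_linear0 X Y : Riem13 G x 0 X Y = 0 /\ Riem13 G x X 0 Y = 0 /\ Riem13 G x X Y 0 = 0.
Proof.
have E A B C : Riem13 G x A B C = C *m curv G A B x by exact: (Riem13E oU smG pdG).
have Z0 : 0 = 0 *: (0 : V) by rewrite scale0r.
rewrite !E mul0mx; split; last split => //.
  by rewrite Z0 (curvZl oU smG pdG _ _ _ Ux) scale0r mulmx0.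
by rewrite Z0 (curvZr oU smG pdG _ _ _ Ux) scale0r mulmx0.
Qed.

Definition const_curv_at k := forall X1 X2 X3 X4, Riem G x X1 X2 X3 X4 =
  k * (met G x X1 X4 * met G x X2 X3 - met G x X1 X3 * met G x X2 X4).

Lemma Ric_const_curv k Y Z : const_curv_at k -> Ric G x Y Z = k * (n%:R - 1) * met G x Y Z.
Proof.
move=> E; rewrite /Ric (eq_gtrace _ (B := fun X W => k * (met G x Y Z * gram (G x) X W -
  gram (G x) X Z * gram (G x) Y W))) => [|X W]; last by rewrite E /met; ring.
rewrite gtraceZ gtraceB gtraceZ gtrace_rank1 // (gtrace_metric pG) /met (gramC Z Y sG).
by ring.
Qed.

Lemma Proj_const_curv k X1 X2 X3 X4 : (1 < n)%N -> const_curv_at k -> Proj G x X1 X2 X3 X4 = 0.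
Proof.
move=> n1 E; have n0 : (n%:R - 1 : R) != 0 by rewrite subr_eq0 gt_eqF // ltr1n.
by rewrite /Proj !(Ric_const_curv _ _ E) E; field.
Qed.

(** The difference [F] of the two sides has the symmetries of a curvature tensor, so it suffices
    that F X Y Y X vanishes. *)
Lemma const_curv_of_sectional k :
  (forall X Y, row_free (col_mx X Y) -> sectional G x X Y = k) -> const_curv_at k.
Proof.
move=> sec X1 X2 X3 X4; apply/eqP; rewrite -subr_eq0; apply/eqP.
move: X1 X2 X3 X4.
pose F (X Y Z W : V) := Riem G x X Y Z W
  - k * (met G x X W * met G x Y Z - met G x X Z * met G x Y W).
have Fl a X X' Y Z W : F (a *: X + X') Y Z W = a * F X Y Z W + F X' Y Z W.
  rewrite /F (Riem_lin1 a X X' Y Z W); move: (Riem G x X Y Z W) (Riem G x X' Y Z W) => r r'.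
  by rewrite /met !(gramDl, gramZl); ring.
have D1 X X' Y Z W : F (X + X') Y Z W = F X Y Z W + F X' Y Z W.
  by have := Fl 1 X X' Y Z W; rewrite scale1r mul1r.
have a12 X Y Z W : F X Y Z W = - F Y X Z W.
  by rewrite /F (Riem_anti12 X Y Z W); move: (Riem G x Y X Z W) => r; ring.
have a34 X Y Z W : F X Y Z W = - F X Y W Z.
  by rewrite /F (Riem_anti34 X Y Z W); move: (Riem G x X Y W Z) => r; ring.
have bi X Y Z W : F X Y Z W + F Y Z X W + F Z X Y W = 0.
  have := Riem_bianchi X Y Z W; rewrite /F.
  move: (Riem G x X Y Z W) (Riem G x Y Z X W) (Riem G x Z X Y W) => r1 r2 r3.
  by rewrite /met (gramC Y X sG) (gramC Z X sG) (gramC Z Y sG) => B;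
     rewrite -[RHS]B; ring.
apply: (curvature_vanish D1 a12 a34 bi) => X Y.
have [fr|] := boolP (row_free (col_mx X Y)).
  have d := gramdet_gt0 pG fr.
  have E := sec _ _ fr; rewrite /sectional in E.
  have d0 : met G x X X * met G x Y Y - met G x X Y ^+ 2 != 0 by rewrite gt_eqF.
  have : Riem G x X Y Y X = k * (met G x X X * met G x Y Y - met G x X Y ^+ 2).
    by rewrite -E divfK.
  by rewrite /F /met (gramC Y X sG) => ->; ring.
(* For a dependent pair the hypothesis on sectional curvature is silent. A relation
   [s *: X + t *: Y = 0] gives [s F = t F = 0] by skew-symmetry. *)
rewrite -kermx_eq0 => /rowV0Pn[v /sub_kermxP].
rewrite -[v]hsubmxK mul_row_col => E v0.
set s := lsubmx v 0 0; set t := rsubmx v 0 0.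
have lE : lsubmx v = s%:M by apply/matrixP => i j; rewrite !ord1 [RHS]mxE mulr1n.
have rE : rsubmx v = t%:M by apply/matrixP => i j; rewrite !ord1 [RHS]mxE mulr1n.
rewrite lE rE !mul_scalar_mx in E.
have F0 A Z W : F A A Z W = 0 by have := a12 A A Z W; lra.
have F00 Y' Z W : F 0 Y' Z W = 0 by have := Fl 1 0 0 Y' Z W; rewrite scaler0 addr0; lra.
have H1 : s * F X Y Y X = 0.
  have := Fl s X (t *: Y) Y Y X; rewrite E F00.
  have := Fl t Y 0 Y Y X; rewrite addr0 F0 F00; lra.
have H2 : t * F X Y Y X = 0.
  have := Fl t Y (s *: X) X Y X; rewrite addrC E F00.
  have := Fl s X 0 X Y X; rewrite addr0 F0 F00 (a12 Y X); lra.
have [s0|s0] := eqVneq s 0; last by move/eqP: H1; rewrite mulf_eq0 (negPf s0) => /eqP.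
have [t0|t0] := eqVneq t 0; last by move/eqP: H2; rewrite mulf_eq0 (negPf t0) => /eqP.
by case/eqP: v0; rewrite lE rE s0 t0 !raddf0 row_mx0.
Qed.

End ChartPoint.

(* The two choices of [A] in the conditions P . H = L Q(A, H), each with the factor [f] such that
   [A u = f l * g u] for every [l]-eigenvector [u] of the Ricci operator. *)
Definition metric_or_Ric (R : realType) (n : nat) (G : 'rV[R]_n -> 'M[R]_n) (x : 'rV[R]_n)
    (A : 'rV[R]_n -> 'rV[R]_n -> R) (f : R -> R) :=
  A = gram (G x) /\ f = (fun _ => 1) \/ A = Ric G x /\ f = id.

Section RoterChartPoint.
Context {R : realType} {n : nat}.
Notation V := 'rV[R]_n.
Variables (G : V -> 'M[R]_n) (U : set V) (x : V).
Hypotheses (oU : open U) (smG : msmooth U G).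
Hypotheses (pdG : forall y, U y -> posdef (G y)) (Ux : U x) (n3 : (3 <= n)%N).
Variables c1 c2 c3 c4 c5 c6 : R.
Let S := ricmx G x.
Hypothesis RmE : forall X1 X2 X3 X4,
  Riem G x X1 X2 X3 X4 = roter (G x) S c1 c2 c3 c4 c5 c6 X1 X2 X3 X4.

Let m : R := (n%:R - 1)^-1.
Let pG : posdef (G x). Proof. exact: pdG. Qed.
Let sS : S^T = S. Proof. exact: (ricmx_sym oU smG pdG Ux). Qed.
Let uG : G x \in unitmx. Proof. exact: posdef_unit. Qed.

Let m_neq0 : m != 0.
Proof. by rewrite invr_neq0 // subr_eq0 gt_eqF // ltr1n; lia. Qed.

Let P := projective (G x) S c1 c2 c3 c4 c5 c6 m.

Let ProjP X Y Z W : Proj G x X Y Z W = P X Y Z W.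
Proof. by rewrite (ProjE oU smG pdG Ux) RmE. Qed.

Let hR X Y Z W : gram (G x) (Riem13 G x X Y Z) W = roter (G x) S c1 c2 c3 c4 c5 c6 X Y Z W.
Proof. exact: RmE. Qed.

Let hP X Y Z W : gram (G x) (Proj13 G x X Y Z) W = P X Y Z W.
Proof. by rewrite (gram_Proj13 oU smG pdG Ux) ProjP. Qed.

Let hRic Y Z : gram S Y Z = gtrace (G x) (fun X W => roter (G x) S c1 c2 c3 c4 c5 c6 X Y Z W).
Proof. by rewrite -(RicE oU smG pdG Ux); apply: eq_gtrace => X W; exact: RmE. Qed.

Lemma const_curv_of_scalar_ric c : S = c *: G x -> exists k, const_curv_at G x k.
Proof.
(* Each Kulkarni-Nomizu product becomes a power of [c] times that of [g] with itself, which is twice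
   the bracket in [const_curv_at]. *)
move=> Sc; exists (2 * c1 + 2 * c2 * c + 2 * c3 * c ^+ 2 + 2 * c4 * c ^+ 2 + 2 * c5 * c ^+ 3
  + 2 * c6 * c ^+ 4) => X1 X2 X3 X4; rewrite RmE /roter /kulkarni_nomizu.
have SE X Y : gram S X Y = c * gram (G x) X Y by rewrite Sc gram_scalemx.
have S2E X Y : gram (sqmx (G x) S) X Y = c ^+ 2 * gram (G x) X Y.
  rewrite /sqmx Sc -scalemxAr -!scalemxAl mulmxV // mul1mx !gram_scalemx.
  by rewrite expr2 mulrA.
by rewrite !SE !S2E /met; ring.
Qed.

Lemma const_curv_of_no_eigenpair :
  (forall a b al be, al != be -> gram (G x) a a = 1 -> gram (G x) b b = 1 ->
     gram (G x) a b = 0 -> eigen (G x) S al a -> eigen (G x) S be b -> False) ->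
  exists k, const_curv_at G x k.
Proof.
move=> no; have [|[c Sc]|[a [b [al [be [ne [aa bb ab] Ha Hb]]]]]] := scalar_or_eigenpair pG sS.
- by lia.
- exact: const_curv_of_scalar_ric Sc.
- by case: (no a b al be).
Qed.

Section Conditions.
Variables (B : V -> V -> R) (fB : R -> R) (L : R).
Hypothesis hB : metric_or_Ric G x B fB.
Hypothesis Lne : forall al be, al != be -> m * (al - be) != L * (fB be - fB al).

Let BE : exists Bm, B = gram Bm /\
  forall l u, eigen (G x) S l u -> forall Z, gram Bm u Z = fB l * gram (G x) u Z.
Proof.
case: hB => -[-> ->]; first by exists (G x); split=> // l u _ Z; rewrite mul1r.
exists S; split=> [|l u Hu Z]; last exact: Hu.
by apply/funext => X; apply/funext => Y; exact: (RicE oU smG pdG Ux).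
Qed.

Lemma const_curv_of_dot11 : (forall X1 X Y,
    dot11 (Proj13 G x) (RicOp G x) X1 X Y = L *: Q11 B (RicOp G x) X1 X Y) ->
  exists k, const_curv_at G x k.
Proof.
have [Bm [-> HB]] := BE => E.
apply: const_curv_of_no_eigenpair => a b al be ne aa bb ab Ha Hb.
exact: (act11_eigenpair pG hP ne aa bb ab Ha Hb (HB _ _ Ha) (HB _ _ Hb) (Lne ne)
  (gram_RicOp oU smG pdG Ux) (fun X => E X a b)).
Qed.

Lemma const_curv_of_dot04 : (forall X1 X2 X3 X4 X Y,
    dot04 (Proj13 G x) (Proj G x) X1 X2 X3 X4 X Y = L * Q04 B (Proj G x) X1 X2 X3 X4 X Y) ->
  exists k, const_curv_at G x k.
Proof.
have [Bm [-> HB]] := BE => E.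
have PE : Proj G x = P.
  by do 4!(apply/funext => ?); exact: ProjP.
rewrite PE in E.
apply: const_curv_of_no_eigenpair => a b al be ne aa bb ab Ha Hb.
have m0 := act04_eigenpair pG hP ne aa bb ab Ha Hb (HB _ _ Ha) (HB _ _ Hb) (Lne ne)
  (fun X1 X2 X3 X4 => E X1 X2 X3 X4 a b).
by move: m_neq0; rewrite m0 eqxx.
Qed.

Lemma const_curv_of_dot13 (H : V -> V -> V -> V) mu :
  (forall c X Y Z, H (c *: X) Y Z = c *: H X Y Z) ->
  (forall X Z, H X 0 Z = 0) -> (forall X Y, H X Y 0 = 0) ->
  (forall l u Z Z', eigen (G x) S l u -> gram (G x) u Z = 0 -> gram (G x) u Z' = 0 ->
     H u Z Z' = (gram (slice (G x) S c1 c2 c3 c4 c5 c6 l) Z Z' - mu * gram S Z Z') *: u) ->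
  (forall X1 X2 X3 X Y,
    dot13 (Proj13 G x) H X1 X2 X3 X Y = L *: Q13 B H X1 X2 X3 X Y) ->
  exists k, const_curv_at G x k.
Proof.
have [Bm [-> HB]] := BE => H1 H2 H3 HE E.
apply: const_curv_of_no_eigenpair => a b al be ne aa bb ab Ha Hb.
exact: (act13_eigenpair pG sS hP hRic ne aa bb ab Ha Hb (HB _ _ Ha) (HB _ _ Hb) (Lne ne)
  H1 H2 H3 HE (fun X1 X2 X3 => E X1 X2 X3 a b)).
Qed.

Lemma const_curv_of_dot13_Riem : (forall X1 X2 X3 X Y,
    dot13 (Proj13 G x) (Riem13 G x) X1 X2 X3 X Y = L *: Q13 B (Riem13 G x) X1 X2 X3 X Y) ->
  exists k, const_curv_at G x k.
Proof.
apply: (@const_curv_of_dot13 _ 0).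
- by move=> c X Y Z; apply: (gram_inj uG) => W; rewrite (hR (c *: X)) gramZl hR roterZ1.
- by move=> X Z; have [_ [h _]] := Riem13_linear0 oU smG pdG Ux X Z; exact: h.
- by move=> X Z; have [_ [_ h]] := Riem13_linear0 oU smG pdG Ux X Z; exact: h.
- move=> l u Z Z' Hu uZ uZ'; rewrite mul0r subr0.
  exact: (R13_eigen pG hR Hu uZ uZ').
Qed.

Lemma const_curv_of_dot13_Proj : (forall X1 X2 X3 X Y,
    dot13 (Proj13 G x) (Proj13 G x) X1 X2 X3 X Y = L *: Q13 B (Proj13 G x) X1 X2 X3 X Y) ->
  exists k, const_curv_at G x k.
Proof.
have z0 : 0 = 0 *: (0 : V) by rewrite scale0r.
apply: (@const_curv_of_dot13 _ m).
- by move=> c X Y Z; apply: (gram_inj uG) => W; rewrite (hP (c *: X)) gramZl hP /P projectiveZ1.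
- by move=> X Z; apply: (gram_inj uG) => W;
  rewrite hP gram0l z0 /P projectiveZ2 mul0r.
- by move=> X Z; apply: (gram_inj uG) => W;
  rewrite hP gram0l z0 /P projectiveZ3 mul0r.
- by move=> l u Z Z' Hu uZ uZ'; exact: (P13_eigen pG hP Hu uZ uZ').
Qed.

End Conditions.

End RoterChartPoint.

(** * The equivalences *)

Section Conditions.
Context {R : realType} {n : nat}.
Notation V := 'rV[R]_n.
Implicit Types (A : V -> V -> R) (L : R) (G : V -> 'M[R]_n) (x : V).

(** The conditions at one point, with the form [A] and the scalar [L] as parameters; [L = 0] covers
    the conditions without [L]. *)
Definition dot11_RicOp_cond A L G x := forall X1 X Y,
  dot11 (Proj13 G x) (RicOp G x) X1 X Y = L *: Q11 A (RicOp G x) X1 X Y.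

Definition dot13_Riem_cond A L G x := forall X1 X2 X3 X Y,
  dot13 (Proj13 G x) (Riem13 G x) X1 X2 X3 X Y = L *: Q13 A (Riem13 G x) X1 X2 X3 X Y.

Definition dot04_Proj_cond A L G x := forall X1 X2 X3 X4 X Y,
  dot04 (Proj13 G x) (Proj G x) X1 X2 X3 X4 X Y = L * Q04 A (Proj G x) X1 X2 X3 X4 X Y.

Definition dot13_Proj_cond A L G x := forall X1 X2 X3 X Y,
  dot13 (Proj13 G x) (Proj13 G x) X1 X2 X3 X Y = L *: Q13 A (Proj13 G x) X1 X2 X3 X Y.

End Conditions.

Section Manifold.
Context {R : realType} {n : nat}.
Variable M : riemannianManifold R n.
Hypothesis n3 : (3 <= n)%N.

Lemma Riem_const_curv i x : constant_curvature M -> chart_cod i x ->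
  exists k, const_curv_at (metric (r := M) i) x k.
Proof.
move=> [k0 cM] cx; exists k0.
apply: (const_curv_of_sectional (@open_cod _ _ M i) (metric_smooth i) (@metric_posdef _ _ M i) cx).
exact: cM.
Qed.

Lemma Proj_const_curvature i x : constant_curvature M -> chart_cod i x ->
  (forall X1 X2 X3 X4, Proj (metric (r := M) i) x X1 X2 X3 X4 = 0) /\
  (forall X Y Z, Proj13 (metric (r := M) i) x X Y Z = 0).
Proof.
move=> cM cx; have [k E] := Riem_const_curv cM cx.
have P0 X1 X2 X3 X4 : Proj (metric (r := M) i) x X1 X2 X3 X4 = 0.
  exact: (Proj_const_curv (@metric_posdef _ _ M i) cx _ _ _ _ (ltnW n3) E).
split=> // X Y Z; rewrite /Proj13 /sharp.
rewrite (_ : \row_a _ = 0) ?mul0mx //.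
by apply/rowP => a; rewrite !mxE P0.
Qed.

Lemma dot11_const_curvature i x X1 X Y : constant_curvature M -> chart_cod i x ->
  dot11 (Proj13 (metric (r := M) i) x) (RicOp (metric i) x) X1 X Y = 0.
Proof.
move=> cM cx; have [_ P0] := Proj_const_curvature cM cx.
rewrite /dot11 /act11 !P0.
by rewrite (RicOpE (@open_cod _ _ M i) (metric_smooth i) (@metric_posdef _ _ M i) cx) !mul0mx subr0.
Qed.

Lemma dot13_Riem_const_curvature i x X1 X2 X3 X Y : constant_curvature M -> chart_cod i x ->
  dot13 (Proj13 (metric (r := M) i) x) (Riem13 (metric i) x) X1 X2 X3 X Y = 0.
Proof.
move=> cM cx; have [_ P0] := Proj_const_curvature cM cx.
have L0 A B := Riem13_linear0 (@open_cod _ _ M i) (metric_smooth i) (@metric_posdef _ _ M i) cx A B.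
have [h1 _] := L0 X2 X3; have [_ [h2 _]] := L0 X1 X3; have [_ [_ h3]] := L0 X1 X2.
by rewrite /dot13 /act13 !P0 h1 h2 h3 !addr0 subr0.
Qed.

Lemma dot04_const_curvature i x X1 X2 X3 X4 X Y : constant_curvature M -> chart_cod i x ->
  dot04 (Proj13 (metric (r := M) i) x) (Proj (metric i) x) X1 X2 X3 X4 X Y = 0.
Proof.
move=> cM cx; have [P0 _] := Proj_const_curvature cM cx.
by rewrite /dot04 /act04 !P0 !addr0 oppr0.
Qed.

Lemma dot13_Proj_const_curvature i x X1 X2 X3 X Y : constant_curvature M -> chart_cod i x ->
  dot13 (Proj13 (metric (r := M) i) x) (Proj13 (metric i) x) X1 X2 X3 X Y = 0.
Proof.
move=> cM cx; have [_ P0] := Proj_const_curvature cM cx.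
by rewrite /dot13 /act13 !P0 !addr0 subr0.
Qed.

Hypothesis M_connected : connected [set: M].
Hypothesis M_Roter : generalized_Roter M.

Lemma roter_chart i x : chart_cod i x -> exists c1 c2 c3 c4 c5 c6, forall X1 X2 X3 X4,
  Riem (metric (r := M) i) x X1 X2 X3 X4 =
  roter (metric i x) (ricmx (metric i) x) c1 c2 c3 c4 c5 c6 X1 X2 X3 X4.
Proof.
move=> cx; have [c1 [c2 [c3 [c4 [c5 [c6 [_ H]]]]]]] := M_Roter.
exists (c1 (chart_inv i x)), (c2 (chart_inv i x)), (c3 (chart_inv i x)),
  (c4 (chart_inv i x)), (c5 (chart_inv i x)), (c6 (chart_inv i x)) => X1 X2 X3 X4.
have /= -> := H i x cx X1 X2 X3 X4.
have -> : Ric (metric (r := M) i) x = gram (ricmx (metric i) x).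
  do 2!(apply/funext => ?).
  exact: (RicE (@open_cod _ _ M i) (metric_smooth i) (@metric_posdef _ _ M i) cx).
have -> : Ric2 (metric (r := M) i) x = gram (sqmx (metric i x) (ricmx (metric i) x)).
  do 2!(apply/funext => ?).
  exact: (Ric2E (@open_cod _ _ M i) (metric_smooth i) (@metric_posdef _ _ M i) cx).
by [].
Qed.

Let m : R := (n%:R - 1)^-1.

Let m_neq0 : m != 0.
Proof. by rewrite invr_neq0 // subr_eq0 gt_eqF // ltr1n; lia. Qed.

Let met_side L al be : al != be -> m * (al - be) != L * (1 - 1).
Proof. by move=> ne; rewrite subrr mulr0 mulf_neq0 // subr_eq0. Qed.

(** For [B = S], [p - q] is [(m + L) (al - be)]: the excluded value of [L] is exactly [- m]. *)
Let Ric_side L al be : L != -1 / (n%:R - 1) -> al != be -> m * (al - be) != L * (be - al).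
Proof.
move=> Ln ne; rewrite -subr_eq0.
have -> : m * (al - be) - L * (be - al) = (m + L) * (al - be) by ring.
rewrite mulf_neq0 ?subr_eq0 //; apply: contra Ln; rewrite addrC addr_eq0 => /eqP ->.
by rewrite mulN1r.
Qed.

Section PointwiseConditions.
Variable C : ('rV[R]_n -> 'rV[R]_n -> R) -> R -> ('rV[R]_n -> 'M[R]_n) -> 'rV[R]_n -> Prop.
Hypothesis C_const_curv : forall i x (B : 'rV[R]_n -> 'rV[R]_n -> R) (fB : R -> R) (L : R),
  chart_cod i x ->
  metric_or_Ric (metric (r := M) i) x B fB ->
  (forall al be, al != be -> m * (al - be) != L * (fB be - fB al)) ->
  C B L (metric i) x -> exists k, const_curv_at (metric (r := M) i) x k.

Lemma const_curv_of_met (L : M -> R) :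
  everywhere (M := M) (fun G x p => C (met G x) (L p) G x) -> constant_curvature M.
Proof.
move=> H; apply: (schur_connected n3 _ M_connected) => i x cx.
apply: (C_const_curv cx _ _ (H i x cx)); first by left.
by move=> al be; exact: met_side.
Qed.

Lemma const_curv_of_Ric (L : M -> R) : (forall p, L p != -1 / (n%:R - 1)) ->
  everywhere (M := M) (fun G x p => C (Ric G x) (L p) G x) -> constant_curvature M.
Proof.
move=> Ln H; apply: (schur_connected n3 _ M_connected) => i x cx.
apply: (C_const_curv cx _ _ (H i x cx)); first by right.
by move=> al be; exact: Ric_side.
Qed.

End PointwiseConditions.

Lemma dot11_RicOp_cond_const_curv i x B fB L : chart_cod i x ->
  metric_or_Ric (metric (r := M) i) x B fB ->
  (forall al be, al != be -> m * (al - be) != L * (fB be - fB al)) ->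
  dot11_RicOp_cond B L (metric i) x -> exists k, const_curv_at (metric (r := M) i) x k.
Proof.
move=> cx hB side; have [c1 [c2 [c3 [c4 [c5 [c6 E]]]]]] := roter_chart cx.
exact: (const_curv_of_dot11 (@open_cod _ _ M i) (metric_smooth i) (@metric_posdef _ _ M i)
  cx n3 E hB side).
Qed.

Lemma dot13_Riem_cond_const_curv i x B fB L : chart_cod i x ->
  metric_or_Ric (metric (r := M) i) x B fB ->
  (forall al be, al != be -> m * (al - be) != L * (fB be - fB al)) ->
  dot13_Riem_cond B L (metric i) x -> exists k, const_curv_at (metric (r := M) i) x k.
Proof.
move=> cx hB side; have [c1 [c2 [c3 [c4 [c5 [c6 E]]]]]] := roter_chart cx.
exact: (const_curv_of_dot13_Riem (@open_cod _ _ M i) (metric_smooth i) (@metric_posdef _ _ M i)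
  cx n3 E hB side).
Qed.

Lemma dot04_Proj_cond_const_curv i x B fB L : chart_cod i x ->
  metric_or_Ric (metric (r := M) i) x B fB ->
  (forall al be, al != be -> m * (al - be) != L * (fB be - fB al)) ->
  dot04_Proj_cond B L (metric i) x -> exists k, const_curv_at (metric (r := M) i) x k.
Proof.
move=> cx hB side; have [c1 [c2 [c3 [c4 [c5 [c6 E]]]]]] := roter_chart cx.
exact: (const_curv_of_dot04 (@open_cod _ _ M i) (metric_smooth i) (@metric_posdef _ _ M i)
  cx n3 E hB side).
Qed.

Lemma dot13_Proj_cond_const_curv i x B fB L : chart_cod i x ->
  metric_or_Ric (metric (r := M) i) x B fB ->
  (forall al be, al != be -> m * (al - be) != L * (fB be - fB al)) ->
  dot13_Proj_cond B L (metric i) x -> exists k, const_curv_at (metric (r := M) i) x k.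
Proof.
move=> cx hB side; have [c1 [c2 [c3 [c4 [c5 [c6 E]]]]]] := roter_chart cx.
exact: (const_curv_of_dot13_Proj (@open_cod _ _ M i) (metric_smooth i) (@metric_posdef _ _ M i)
  cx n3 E hB side).
Qed.

End Manifold.

Theorem theorem4p17 (R : realType) (n : nat) (M : riemannianManifold R n)
    (n_ge3 : (3 <= n)%N) (M_connected : connected [set: M])
    (M_Roter : generalized_Roter M) :
  [<->
    (* (i) *)
    everywhere (M := M) (fun G x p => forall X1 X Y,
      dot11 (Proj13 G x) (RicOp G x) X1 X Y = 0);
    (* (ii) *)
    exists L : M -> R, everywhere (M := M) (fun G x p => forall X1 X Y,
      dot11 (Proj13 G x) (RicOp G x) X1 X Y =
      L p *: Q11 (met G x) (RicOp G x) X1 X Y);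
    (* (iii) *)
    everywhere (M := M) (fun G x p => forall X1 X2 X3 X Y,
      dot13 (Proj13 G x) (Riem13 G x) X1 X2 X3 X Y = 0);
    (* (iv) *)
    exists L : M -> R, everywhere (M := M) (fun G x p => forall X1 X2 X3 X Y,
      dot13 (Proj13 G x) (Riem13 G x) X1 X2 X3 X Y =
      L p *: Q13 (met G x) (Riem13 G x) X1 X2 X3 X Y);
    (* (v) *)
    exists L : M -> R, (forall p, L p != -1 / (n%:R - 1)) /\
      everywhere (M := M) (fun G x p => forall X1 X2 X3 X Y,
        dot13 (Proj13 G x) (Riem13 G x) X1 X2 X3 X Y =
        L p *: Q13 (Ric G x) (Riem13 G x) X1 X2 X3 X Y);
    (* (vi) *)
    everywhere (M := M) (fun G x p => forall X1 X2 X3 X4 X Y,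
      dot04 (Proj13 G x) (Proj G x) X1 X2 X3 X4 X Y = 0);
    (* (vii) *)
    exists L : M -> R, everywhere (M := M) (fun G x p => forall X1 X2 X3 X4 X Y,
      dot04 (Proj13 G x) (Proj G x) X1 X2 X3 X4 X Y =
      L p * Q04 (met G x) (Proj G x) X1 X2 X3 X4 X Y);
    (* (viii) *)
    exists L : M -> R, (forall p, L p != -1 / (n%:R - 1)) /\
      everywhere (M := M) (fun G x p => forall X1 X2 X3 X4 X Y,
        dot04 (Proj13 G x) (Proj G x) X1 X2 X3 X4 X Y =
        L p * Q04 (Ric G x) (Proj G x) X1 X2 X3 X4 X Y);
    (* (ix) *)
    everywhere (M := M) (fun G x p => forall X1 X2 X3 X Y,
      dot13 (Proj13 G x) (Proj13 G x) X1 X2 X3 X Y = 0);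
    (* (x) *)
    exists L : M -> R, everywhere (M := M) (fun G x p => forall X1 X2 X3 X Y,
      dot13 (Proj13 G x) (Proj13 G x) X1 X2 X3 X Y =
      L p *: Q13 (met G x) (Proj13 G x) X1 X2 X3 X Y);
    (* (xi) *)
    exists L : M -> R, (forall p, L p != -1 / (n%:R - 1)) /\
      everywhere (M := M) (fun G x p => forall X1 X2 X3 X Y,
        dot13 (Proj13 G x) (Proj13 G x) X1 X2 X3 X Y =
        L p *: Q13 (Ric G x) (Proj13 G x) X1 X2 X3 X Y);
    (* (xii) *)
    constant_curvature M].

Proof.
have met11 := const_curv_of_met n_ge3 M_connected (C := dot11_RicOp_cond)
  (dot11_RicOp_cond_const_curv n_ge3 M_Roter).
have met13R := const_curv_of_met n_ge3 M_connected (C := dot13_Riem_cond)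
  (dot13_Riem_cond_const_curv n_ge3 M_Roter).
have met04 := const_curv_of_met n_ge3 M_connected (C := dot04_Proj_cond)
  (dot04_Proj_cond_const_curv n_ge3 M_Roter).
have met13P := const_curv_of_met n_ge3 M_connected (C := dot13_Proj_cond)
  (dot13_Proj_cond_const_curv n_ge3 M_Roter).
have Ric13R := const_curv_of_Ric n_ge3 M_connected (C := dot13_Riem_cond)
  (dot13_Riem_cond_const_curv n_ge3 M_Roter).
have Ric04 := const_curv_of_Ric n_ge3 M_connected (C := dot04_Proj_cond)
  (dot04_Proj_cond_const_curv n_ge3 M_Roter).
have Ric13P := const_curv_of_Ric n_ge3 M_connected (C := dot13_Proj_cond)
  (dot13_Proj_cond_const_curv n_ge3 M_Roter).
(* [L = 0] is the witness in every condition with [L]; it has to avoid the excluded value. *)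
have L0 (p : M) : 0 != -1 / (n%:R - 1) :> R.
  by rewrite eq_sym mulf_neq0 ?oppr_eq0 ?oner_eq0 // invr_neq0 // subr_eq0 gt_eqF // ltr1n; lia.
have z11 := @dot11_const_curvature R n M n_ge3.
have z13R := @dot13_Riem_const_curvature R n M n_ge3.
have z04 := @dot04_const_curvature R n M n_ge3.
have z13P := @dot13_Proj_const_curvature R n M n_ge3.
(* The implications are cyclic. A condition with [L] gives constant curvature, where P = 0 yields
   the next one; a condition [P . H = 0] gives the next one with [L = 0]. *)
tfae.
- by move=> H; exists (fun _ => 0) => i x cx X1 X Y; rewrite scale0r; exact: H.
- by case=> L /met11 cM i x cx X1 X2 X3 X Y; exact: z13R.
- by move=> H; exists (fun _ => 0) => i x cx X1 X2 X3 X Y; rewrite scale0r; exact: H.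
- case=> L /met13R cM; exists (fun _ => 0); split=> // i x cx X1 X2 X3 X Y.
  by rewrite scale0r; exact: z13R.
- by case=> L [Ln /(Ric13R L Ln) cM] i x cx X1 X2 X3 X4 X Y; exact: z04.
- by move=> H; exists (fun _ => 0) => i x cx X1 X2 X3 X4 X Y; rewrite mul0r; exact: H.
- case=> L /met04 cM; exists (fun _ => 0); split=> // i x cx X1 X2 X3 X4 X Y.
  by rewrite mul0r; exact: z04.
- by case=> L [Ln /(Ric04 L Ln) cM] i x cx X1 X2 X3 X Y; exact: z13P.
- by move=> H; exists (fun _ => 0) => i x cx X1 X2 X3 X Y; rewrite scale0r; exact: H.
- case=> L /met13P cM; exists (fun _ => 0); split=> // i x cx X1 X2 X3 X Y.
  by rewrite scale0r; exact: z13P.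
- by case=> L [Ln /(Ric13P L Ln)].
- by move=> cM i x cx X1 X Y; exact: z11.
Qed.
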